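(* Let $D\ge 1$ be an integer, let $U\subset\mathbb{R}^D$ be a $D$-dimensional subset with Borel $\sigma$-field $\mathcal{B}$, and let $H$ be a non-atomic probability measure on $(U,\mathcal{B})$, i.e. $H(\{y\})=0$ for every $y\in U$. Denote the correlation matrix of the distribution $H$ by $\mathbf{R}_H$. Let $\alpha,\gamma,\nu>0$, and let $G^{(1)},\ldots,G^{(m)}$ be random probability measures on $(U,\mathcal{B})$ drawn from the hybrid NDP-HDP prior (defined in the context) $$G_0\sim \mathrm{DP}(\alpha,H),\qquad G^{(j)}\overset{i.i.d.}{\sim}\mathrm{DP}(\nu,\mathrm{DP}(\gamma,G_0)),\quad j=1,\ldots,m.$$ Then for any Borel set $A\in\mathcal{B}$: (1) $\mathbb{E}\left(G^{(j)}(A)\mid H\right)=H(A)$. (2) $\displaystyle \mathbb{V}\left(G^{(j)}(A)\mid H\right)=\frac{(\alpha+\gamma+1)\,H(A)\,(1-H(A))}{(\alpha+1)(\gamma+1)}$, where $\mathbb{V}$ denotes variance. (3) $\displaystyle \mathrm{Cor}\left(G^{(j)}(A),G^{(j')}(A)\mid H\right)=\frac{1}{1+\nu}\cdot\frac{\nu\gamma+\alpha+\gamma+\nu+1}{\alpha+\gamma+1}$ for $j\ne j'$. (4) When $D=1$, let $\mu_i^{(j)}$ and $\mu_{i'}^{(j')}$ denote random variables from $G^{(j)}$ and $G^{(j')}$, respectively. The correlation between $\mu_i^{(j)}$ and $\mu_{i'}^{(j')}$ is $$\mathrm{Cor}\left(\mu_i^{(j)},\mu_{i'}^{(j')}\right)=\begin{cases}\dfrac{\alpha+\gamma+1}{(\alpha+1)(\gamma+1)}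 & \text{for } j=j',\ i\ne i',\\[2mm] \dfrac{\nu\gamma+\alpha+\gamma+\nu+1}{(\nu+1)(\alpha+1)(\gamma+1)} & \text{for } j\neq j'.\end{cases}$$ (5) When $D\ge 2$, let $\boldsymbol\mu_i^{(j)}$ and $\boldsymbol\mu_{i'}^{(j')}$ denote random vectors from $G^{(j)}$ and $G^{(j')}$, respectively. The correlation matrix between $\boldsymbol\mu_i^{(j)}$ and $\boldsymbol\mu_{i'}^{(j')}$ is $$\mathrm{Cor}\left(\boldsymbol\mu_i^{(j)},\boldsymbol\mu_{i'}^{(j')}\right)=\begin{cases}\dfrac{\alpha+\gamma+1}{(\alpha+1)(\gamma+1)}\,\mathbf{R}_H & \text{for } j=j',\ i\ne i',\\[2mm] \dfrac{\nu\gamma+\alpha+\gamma+\nu+1}{(\nu+1)(\alpha+1)(\gamma+1)}\,\mathbf{R}_H & \text{for } j\neq j'.\end{cases}$$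
   Context: Dirichlet process (stick-breaking form): for $a>0$ and a probability measure $P_0$ on a measurable space, $P\sim\mathrm{DP}(a,P_0)$ means $P=\sum_{k=1}^\infty \pi_k\delta_{\theta_k}$, where $\delta_\theta$ is the Dirac measure at $\theta$, $\pi_k=\psi_k\prod_{t<k}(1-\psi_t)$ with $\psi_1,\psi_2,\ldots$ i.i.d. $\mathrm{Beta}(1,a)$, and the atoms $\theta_1,\theta_2,\ldots$ are i.i.d. from $P_0$, independent of the $\psi_k$'s. Hybrid NDP-HDP prior: first $G_0\sim\mathrm{DP}(\alpha,H)$. Given $G_0$, let $Q=\sum_{k=1}^\infty\phi_k\delta_{G^*_k}$, where $G^*_1,G^*_2,\ldots$ are, given $G_0$, i.i.d. from $\mathrm{DP}(\gamma,G_0)$, and the weights are $\phi_k=\psi'_k\prod_{t<k}(1-\psi'_t)$ with $\psi'_1,\psi'_2,\ldots$ i.i.d. $\mathrm{Beta}(1,\nu)$ independent of $G_0$ and of the $G^*_k$'s. The notation $G^{(j)}\overset{i.i.d.}{\sim}\mathrm{DP}(\nu,\mathrm{DP}(\gamma,G_0))$ means that, given $Q$, the random measures $G^{(1)},\ldots,G^{(m)}$ are i.i.d. from $Q$, i.e. $\mathbb{P}(G^{(j)}=G^*_k\mid Q)=\phi_k$ (selection of index $k$). Given the $G^{(j)}$'s, the draws $\boldsymbol\mu^{(j)}_i\sim G^{(j)}$ (written $\mu^{(j)}_i$ when $D=1$) are independent over all $(i,j)$. Conditioning on $H$ means that the base measure $H$ is treated as fixed while $G_0$, $Q$ and the $G^{(j)}$'s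 are random; $\mathrm{Cor}$ in (4) and (5) is computed under the marginal law of the draws with all of these random measures integrated out. The correlation matrix between two $D$-dimensional random vectors $V,W$ is the $D\times D$ matrix with $(g,g')$ entry equal to the correlation of $V_g$ and $W_{g'}$; $\mathbf{R}_H$ is the matrix with $(g,g')$ entry equal to the correlation of coordinates $g$ and $g'$ of a random vector with law $H$. *)

(* Defs.v *)
From HB Require Import structures.
From mathcomp Require Import all_boot all_order all_algebra.
From mathcomp Require Import all_classical all_reals all_analysis.

Set Implicit Arguments.
Unset Strict Implicit.
Unset Printing Implicit Defensive.

Import Order.TTheory GRing.Theory Num.Theory.
Import numFieldNormedType.Exports.

Local Open Scope classical_set_scope.
Local Open Scope ring_scope.

(* A subset U of R^D with its Borel sigma-field, i.e. the sigma-field generated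
   by the open sets of the subspace topology.  The base point u0 is only there
   because measurable types are pointed in the library. *)
Definition pointed_subset (R : realType) (D : nat) (U : set 'rV[R]_D)
  (u0 : set_type U) : Type := set_type U.

HB.instance Definition _ (R : realType) (D : nat) (U : set 'rV[R]_D)
  (u0 : set_type U) := Topological.on (pointed_subset u0).
HB.instance Definition _ (R : realType) (D : nat) (U : set 'rV[R]_D)
  (u0 : set_type U) := isPointed.Build (pointed_subset u0) u0.

Definition borel_subset (R : realType) (D : nat) (U : set 'rV[R]_D)
  (u0 : set_type U) := g_sigma_algebraType (@open (pointed_subset u0)).

Definition to_rV (R : realType) (D : nat) (U : set 'rV[R]_D) (u0 : set_type U)
  (x : borel_subset u0) : 'rV[R]_D := \val (x : set_type U).

Section correlation.
Context d (T : measurableType d) (R : realType) (P : probability T R).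

(* Equal to 0 as soon as one of the variances is 0, since x / 0 = 0. *)
Definition correlation (X Y : T -> R) : R :=
  fine (covariance P X Y)
    / (Num.sqrt (fine (variance P X)) * Num.sqrt (fine (variance P Y))).

Definition correlation_mx (D : nat) (V W : T -> 'rV[R]_D) : 'M[R]_D :=
  \matrix_(g, g')
    correlation (fun w => V w ord0 g) (fun w => W w ord0 g').

End correlation.

(* The library's [beta_prob] only has natural number parameters. *)
Section beta_law.
Context (R : realType).
Implicit Types a b : R.

Definition beta_kernel a b (x : R) : R := x `^ (a - 1) * (1 - x) `^ (b - 1).

Definition beta_norm a b : R :=
  \int[lebesgue_measure]_(x in `]0, 1[) beta_kernel a b x.

Definition beta_law a b (A : set R) : \bar R :=
  (\int[lebesgue_measure]_(x in A `&` `]0%R, 1%R[)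
     (beta_kernel a b x / beta_norm a b)%:E)%E.

End beta_law.

Definition sigma_of (Omega I : Type) d (T : measurableType d)
  (X : I -> Omega -> T) : set (set Omega) :=
  <<s \bigcup_i preimage_set_system setT (X i) measurable >>.

Section conditional_independence.
Context dO (Omega : measurableType dO) (R : realType) (P : probability Omega R).
Context d (T : measurableType d).

(* Given the sigma-field F, the X i are mutually independent and X i has the
   (random) law L i.  Provided that each L i is F-measurable, this is the
   defining property of the conditional law of (X i)_i given F; when F contains
   the sigma-field of other variables and L is constant, it says that the X i
   are independent of these variables. *)
Definition cond_indep (F : set (set Omega)) (I : eqType)
  (L : I -> Omega -> set T -> \bar R) (X : I -> {RV P >-> T}) : Prop :=
  forall (E : set Omega) (J : seq I) (A : I -> set T),
    F E -> uniq J -> (forall i, measurable (A i)) ->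
    P (E `&` \bigcap_(i in [set` J]) (X i @^-1` A i))
      = (\int[P]_(w in E) \prod_(i <- J) L i w (A i))%E.

Definition stick_weight (psi : nat -> Omega -> R) (k : nat) (w : Omega) : R :=
  psi k w * \prod_(t < k) (1 - psi t w).

Definition stick_breaking (psi : nat -> Omega -> R) (theta : nat -> Omega -> T)
  (X : Omega -> probability T R) : Prop :=
  {ae P, forall w, forall A, measurable A ->
    X w A = (\sum_(0 <= k <oo) (stick_weight psi k w)%:E * \d_(theta k w) A)%E}.

End conditional_independence.

Section dirichlet.
Context dO (Omega : measurableType dO) (R : realType) (P : probability Omega R).
Context d (T : measurableType d).

(* Given F, the X i are i.i.d. from DP(a, P0), where P0 is F-measurable.  The
   atoms are drawn given F and all the sticks: they are independent of the
   sticks given F. *)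
Definition iid_DP (F : set (set Omega)) (a : R) (P0 : Omega -> probability T R)
  (I : eqType) (X : I -> {RV P >-> pprobability T R}) : Prop :=
  exists (psi : I * nat -> {RV P >-> R}) (theta : I * nat -> {RV P >-> T}),
    [/\ cond_indep F (fun _ _ => beta_law 1 a) psi,
        cond_indep <<s F `|` sigma_of psi >> (fun _ w => P0 w) theta &
        forall i, stick_breaking P (fun k => psi (i, k))
                    (fun k => theta (i, k)) (X i)].

(* G_0 ~ DP(alpha, H); given G_0, the Gstar k are i.i.d. from DP(gamma, G_0);
   Q has atoms Gstar k and stick-breaking weights built from psi, which is
   i.i.d. Beta(1, nu) and independent of (G_0, Gstar); given Q, the G j are
   i.i.d. from the probability measure Q on the space of probability measures,
   hence Gstar k is selected with probability its weight. *)
Definition NDP_HDP (alpha gamma nu : R) (H : probability T R) (m : nat)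
  (G : 'I_m -> {RV P >-> pprobability T R}) : Prop :=
  exists (G0 : {RV P >-> pprobability T R})
         (Gstar : nat -> {RV P >-> pprobability T R})
         (psi : nat -> {RV P >-> R})
         (Q : {RV P >-> pprobability (pprobability T R) R}),
    let F0 := sigma_of (fun _ : unit => G0) in
    [/\ iid_DP [set set0; setT] alpha (fun _ => H) (fun _ : unit => G0),
        iid_DP F0 gamma G0 Gstar,
        cond_indep <<s F0 `|` sigma_of Gstar >> (fun _ _ => beta_law 1 nu) psi,
        stick_breaking P psi Gstar Q &
        cond_indep (sigma_of (fun _ : unit => Q))
          (fun _ w => (Q w : probability _ R)) G].

Definition draws (m : nat) (G : 'I_m -> {RV P >-> pprobability T R})
  (n : 'I_m -> nat) (mu : forall j, 'I_(n j) -> {RV P >-> T}) : Prop :=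
  cond_indep (sigma_of G)
    (fun (u : {j : 'I_m & 'I_(n j)}) w => (G (tag u) w : probability T R))
    (fun u => mu (tag u) (tagged u)).

End dirichlet.

(* Main.v *)
(* The correlations only depend on the two-point laws P(mu \in A, mu' \in B), and
   each layer of the hierarchy turns a two-point law into a mixture of its
   diagonal and its off-diagonal parts.  If pi_k are stick-breaking weights with
   i.i.d. Beta(1, a) sticks, then sum_k pi_k = 1 (because the random measure has
   total mass 1) and E sum_k pi_k^2 = 1 / (1 + a).  Expanding X(A) X(B) as a
   double series over the atoms, the diagonal terms contribute with total weight
   1 / (1 + a) and the others with total weight a / (1 + a).  Applied to G_0, to
   the G*_k given G_0, and to the choice of an atom of Q, this gives
     P(mu \in A, mu' \in B) = c H(A `&` B) + (1 - c) H(A) H(B),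
   where c is one of the two constants of the theorem.  Such a pair has
   covariance E f(mu) g(mu') - E f(mu) E g(mu') = c Cov_H(f, g). *)

Require Import Defs.
From HB Require Import structures.
From mathcomp Require Import all_boot all_order all_algebra.
From mathcomp Require Import all_classical all_reals all_analysis.
From mathcomp Require Import measurable_realfun.
From mathcomp Require Import ring lra.

Set Implicit Arguments.
Unset Strict Implicit.
Unset Printing Implicit Defensive.

Import Order.TTheory GRing.Theory Num.Theory.
Import numFieldNormedType.Exports.

Local Open Scope classical_set_scope.
Local Open Scope ring_scope.

(** * Laws weighted by a density *)

(** Conditional independence is given only on events: a set of the conditioning sigma-field
    intersected with finitely many preimages. The argument needs it for functions, such as products
    of stick weights or the map sending a probability p to p(A) p(B). The bridge avoids conditional
    expectations. An identity tested on events says that two measures of the form [A] maps to the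
    integral of [W] over the preimage of [A] under [X] coincide, so they integrate every nonnegative
    function alike. When [X] is the identity into a smaller sigma-field, this plays the part of the
    tower property. Everything is kept nonnegative in the extended reals, so that series and
    integrals commute without integrability conditions. Since sticks lie in ]0, 1[ only almost
    surely, weights are replaced by their absolute values. The order of conditioning matters: atoms
    are first integrated out given the base measure and all sticks, which leaves a function of the
    base measure alone; only then do the weights separate from it. *)

Lemma integral_probability_cst d (Omega : measurableType d) (R : realType)
  (P : probability Omega R) (c : \bar R) : (\int[P]_w c = c)%E.
Proof. by rewrite integral_cst// [X in (_ * X)%E](@probability_setT _ _ _ P) mule1. Qed.

Section weighted_law.
Local Open Scope ereal_scope.
Context d d' (Omega : measurableType d) (T : measurableType d') (R : realType).
Variable mu : {measure set Omega -> \bar R}.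

(* The unused arguments mX, mW and W0 let the measure instance below be
   inferred. *)
Definition weighted_law (X : Omega -> T) (mX : measurable_fun setT X)
    (W : Omega -> \bar R) (mW : measurable_fun setT W)
    (W0 : forall w, 0 <= W w) (A : set T) : \bar R :=
  \int[mu]_(w in X @^-1` A) W w.

Variables (X : Omega -> T) (mX : measurable_fun setT X).
Variables (W : Omega -> \bar R) (mW : measurable_fun setT W).
Hypothesis W0 : forall w, 0 <= W w.

Local Notation law := (weighted_law mX mW W0).

Let mpre A : measurable A -> measurable (X @^-1` A).
Proof. by move=> mA; rewrite -[X in measurable X]setTI; exact: mX. Qed.

Let law0 : law set0 = 0.
Proof. by rewrite /weighted_law preimage_set0 integral_set0. Qed.

Let law_ge0 A : 0 <= law A.
Proof. exact: integral_ge0. Qed.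

Let law_sigma_additive : semi_sigma_additive law.
Proof.
move=> F mF tF mUF; rewrite /weighted_law preimage_bigcup; apply: cvg_toP.
  apply: ereal_nondecreasing_is_cvgn => m n mn.
  by apply: lee_sum_nneg_natr => // k _ _; exact: integral_ge0.
rewrite ge0_integral_bigcup//.
- by move=> k; exact: mpre.
- exact: measurable_funTS.
- apply/trivIsetP => i j _ _ ij; rewrite -preimage_setI.
  by move/trivIsetP : tF => /(_ _ _ _ _ ij) ->//; rewrite preimage_set0.
Qed.

HB.instance Definition _ := isMeasure.Build _ _ _ law
  law0 law_ge0 law_sigma_additive.

Import HBNNSimple.

(** Change of variables for the image under [X] of the measure with density [W]. Indicators give the
    definition of the law, and increasing simple functions give the rest, even where [W] is
    infinite. *)
Lemma ge0_integral_weighted_law (h : T -> \bar R) :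
  measurable_fun setT h -> (forall x, 0 <= h x) ->
  \int[law]_x h x = \int[mu]_w (h (X w) * W w).
Proof.
move=> mh h0; pose h_ := nnsfun_approx measurableT mh.
have mh_ n : measurable_fun setT (EFin \o h_ n).
  exact/measurable_EFinP/measurable_funP.
have cvgh x : limn (fun n => (h_ n x)%:E) = h x.
  by apply/cvg_lim => //; apply: cvg_nnsfun_approx.
have ndh x : nondecreasing_seq (fun n => (h_ n x)%:E).
  by move=> m n mn; rewrite lee_fin; exact/lefP/nd_nnsfun_approx.
have mhW n : measurable_fun setT (fun w => (h_ n (X w))%:E * W w).
  by apply: emeasurable_funM => //; exact: measurableT_comp (mh_ n) mX.
transitivity (limn (fun n => \int[law]_x (h_ n x)%:E)).
  rewrite -monotone_convergence//=.
  - by apply: eq_integral => x _; rewrite cvgh.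
  - by move=> n x _; rewrite lee_fin.
transitivity (limn (fun n => \int[mu]_w ((h_ n (X w))%:E * W w))); last first.
  rewrite -monotone_convergence//=.
  - apply: eq_integral => w _; apply/cvg_lim => //.
    (* The extended product is not continuous at 0 times infinity, so the zeros of [W] and of [h]
       are treated apart. Where [h] vanishes, so does each [h_ n], because [h_ n] lies below [h]. *)
    have [->|Wn0] := eqVneq (W w) 0.
      by under eq_fun do rewrite mule0; rewrite mule0; exact: cvg_cst.
    have [h00|hn0] := eqVneq (h (X w)) 0.
      have h_0 n : (h_ n (X w))%:E = 0.
        apply/eqP; rewrite eq_le; apply/andP; split; last by rewrite lee_fin.
        have : (h_ n (X w))%:E <= h (X w).
          rewrite -cvgh; apply: lime_ge; first exact: ereal_nondecreasing_is_cvgn.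
          by exists n => // m /= nm; exact: ndh.
        by rewrite h00 lee_fin.
      rewrite h00 mul0e [X in X @ _](_ : _ = cst 0); first exact: cvg_cst.
      by apply/funext => n; rewrite h_0 mul0e.
    apply: cvgeM; [|exact: cvg_nnsfun_approx|exact: cvg_cst].
    have [Wfin|Wfin] := boolP (W w \is a fin_num); last exact: mule_def_neq0_infty.
    have [hfin|hfin] := boolP (h (X w) \is a fin_num); first exact: mule_def_fin.
    exact: mule_def_infty_neq0.
  - by move=> n w _; rewrite mule_ge0// lee_fin.
  - by move=> w _ m n mn; rewrite lee_wpmul2r//; exact: ndh.
congr (limn _); apply/funext => n.
rewrite integralT_nnsfun sintegralE.
have mind r : measurable_fun setT (fun w => (\1_(h_ n @^-1` [set r]) (X w) : R)).
  apply: (measurableT_comp _ mX); apply: measurable_indic.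
  exact: measurable_sfunP.
transitivity (\sum_(x \in range (h_ n))
    \int[mu]_w ((x * \1_(h_ n @^-1` [set x]) (X w))%:E * W w)); last first.
  rewrite -ge0_integral_fsum//.
  - apply: eq_integral => w _; rewrite [in RHS]fimfunE.
    rewrite -fsumEFin// ge0_mule_fsuml// => r.
    exact: nnfun_muleindic_ge0.
  - move=> r; apply: emeasurable_funM => //; apply/measurable_EFinP.
    exact: measurable_funM.
  - by move=> r w _; rewrite mule_ge0//; exact: nnfun_muleindic_ge0.
apply: eq_fsbigr => r /set_mem [y _ <-].
under eq_integral do rewrite EFinM -muleA.
rewrite ge0_integralZl_EFin//; last 2 first.
- by move=> w _; rewrite mule_ge0.
- by apply: emeasurable_funM => //; exact/measurable_EFinP.
congr (_ * _); rewrite /weighted_law [LHS]integral_mkcond epatch_indic.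
by apply: eq_integral => w _; rewrite muleC.
Qed.

End weighted_law.

Section eq_weighted_law.
Local Open Scope ereal_scope.
Context d (T : measurableType d) (R : realType).

(** Both sides are integrals of [h] for weighted laws on [T], and the hypothesis says that these two
    measures are equal. This is the device that turns every identity on events into one on
    functions. *)
Lemma eq_integral_weighted_law d1 d2 (Omega1 : measurableType d1)
    (Omega2 : measurableType d2) (mu1 : {measure set Omega1 -> \bar R})
    (mu2 : {measure set Omega2 -> \bar R}) (X1 : Omega1 -> T) (X2 : Omega2 -> T)
    (W1 : Omega1 -> \bar R) (W2 : Omega2 -> \bar R) :
  measurable_fun setT X1 -> measurable_fun setT X2 ->
  measurable_fun setT W1 -> measurable_fun setT W2 ->
  (forall w, 0 <= W1 w) -> (forall w, 0 <= W2 w) ->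
  (forall A, measurable A ->
    \int[mu1]_(w in X1 @^-1` A) W1 w = \int[mu2]_(w in X2 @^-1` A) W2 w) ->
  forall h : T -> \bar R, measurable_fun setT h -> (forall x, 0 <= h x) ->
  \int[mu1]_w (h (X1 w) * W1 w) = \int[mu2]_w (h (X2 w) * W2 w).
Proof.
move=> mX1 mX2 mW1 mW2 W10 W20 e h mh h0.
rewrite -(ge0_integral_weighted_law mu1 mX1 mW1 W10 mh h0).
rewrite -(ge0_integral_weighted_law mu2 mX2 mW2 W20 mh h0).
by apply: eq_measure_integral => A mA _; exact: e.
Qed.

(** Variant in which the second measure is a countable sum of weighted laws, as happens when a
    random measure is expanded over its atoms. *)
Lemma eq_integral_weighted_law_series d1 d2 (Omega1 : measurableType d1)
    (Omega2 : measurableType d2) (mu1 : {measure set Omega1 -> \bar R})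
    (mu2 : {measure set Omega2 -> \bar R}) (X : Omega1 -> T)
    (Y : nat -> Omega2 -> T) (W : Omega1 -> \bar R) (V : nat -> Omega2 -> \bar R) :
  measurable_fun setT X -> (forall k, measurable_fun setT (Y k)) ->
  measurable_fun setT W -> (forall k, measurable_fun setT (V k)) ->
  (forall w, 0 <= W w) -> (forall k w, 0 <= V k w) ->
  (forall A, measurable A ->
    \int[mu1]_(w in X @^-1` A) W w =
    \sum_(0 <= k <oo) \int[mu2]_(w in Y k @^-1` A) V k w) ->
  forall h : T -> \bar R, measurable_fun setT h -> (forall x, 0 <= h x) ->
  \int[mu1]_w (h (X w) * W w) =
  \sum_(0 <= k <oo) \int[mu2]_w (h (Y k w) * V k w).
Proof.
move=> mX mY mW mV W0 V0 e h mh h0.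
rewrite -(ge0_integral_weighted_law mu1 mX mW W0 mh h0).
pose m k : {measure set T -> \bar R} :=
  weighted_law mu2 (mY k) (mV k) (V0 k).
transitivity (\int[mseries m 0]_x h x).
  by apply: eq_measure_integral => A mA _; exact: e.
rewrite ge0_integral_measure_series//.
by apply: eq_eseriesr => k _; rewrite ge0_integral_weighted_law.
Qed.

End eq_weighted_law.

Section sub_sigma_algebra.
Local Open Scope ereal_scope.
Context d (Omega : measurableType d) (R : realType).
Variable (G : set (set Omega)).
Hypothesis GO : <<s G >> `<=` measurable.

Lemma sub_sigma_algebra_measurable_fun d' (T : measurableType d')
    (Y : g_sigma_algebraType G -> T) :
  measurable_fun setT Y -> measurable_fun setT (Y : Omega -> T).
Proof.
move=> mY _ A mA; rewrite setTI; apply: GO.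
by have := mY measurableT A mA; rewrite setTI.
Qed.

(** The hypothesis says that [W1] and [W2] have the same conditional expectation given [<<s G>>].
    The identity map into the coarser measurable space serves as the random variable whose weighted
    laws are compared. *)
Lemma eq_integral_sub_sigma_algebra (mu : {measure set Omega -> \bar R})
    (W1 W2 : Omega -> \bar R) :
  measurable_fun setT W1 -> measurable_fun setT W2 ->
  (forall w, 0 <= W1 w) -> (forall w, 0 <= W2 w) ->
  (forall E, <<s G >> E -> \int[mu]_(w in E) W1 w = \int[mu]_(w in E) W2 w) ->
  forall Y : g_sigma_algebraType G -> \bar R,
    measurable_fun setT Y -> (forall w, 0 <= Y w) ->
  \int[mu]_w (Y w * W1 w) = \int[mu]_w (Y w * W2 w).
Proof.
move=> mW1 mW2 W10 W20 e Y mY Y0.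
have mid : measurable_fun [set: Omega] (id : Omega -> g_sigma_algebraType G).
  exact: (@sub_sigma_algebra_measurable_fun _ (g_sigma_algebraType G)).
exact: (@eq_integral_weighted_law _ (g_sigma_algebraType G) _ _ _ _ _ mu mu
  id id).
Qed.

End sub_sigma_algebra.

(** * Conditional independence and integrals of products *)

Section constant_law.
Local Open Scope ereal_scope.
Context d (Omega : measurableType d) (R : realType) (P : probability Omega R).
Context d' (T : measurableType d') (I : eqType).
Variable (G : set (set Omega)).
Hypothesis GO : <<s G >> `<=` measurable.
Variables (rho : set T -> \bar R) (X : I -> {RV P >-> T}).
Hypothesis indep : cond_indep <<s G >> (fun _ _ => rho) X.

Lemma cond_indep_law i A : measurable A -> P (X i @^-1` A) = rho A.
Proof.
move=> mA.
have [sG0 sGC _] := smallest_sigma_algebra setT G.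
have GT : <<s G >> setT by have := sGC _ sG0; rewrite setD0.
have := indep GT (isT : uniq [:: i]) (fun _ => mA).
rewrite (_ : [set` [:: i]] = [set i]); last first.
  by apply/seteqP; split=> j /=; rewrite inE => /eqP.
rewrite bigcap_set1 setTI => ->.
under eq_integral do rewrite big_seq1.
exact: integral_probability_cst.
Qed.

Lemma prode_comp_ge0 (h : I -> T -> \bar R) (J : seq I) w :
  (forall i x, 0 <= h i x) -> 0 <= \prod_(i <- J) h i (X i w).
Proof.
move=> h0; by apply: (big_ind (fun x => 0 <= x)) => // x y; exact: mule_ge0.
Qed.

Lemma measurable_prode_comp (h : I -> T -> \bar R) (J : seq I) :
  (forall i, measurable_fun setT (h i)) ->
  measurable_fun setT (fun w => \prod_(i <- J) h i (X i w)).
Proof.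
move=> mh; elim: J => [|i J IH].
  by under eq_fun do rewrite big_nil; exact: measurable_cst.
under eq_fun do rewrite big_cons; apply: emeasurable_funM => //.
by apply: measurableT_comp; [exact: mh|exact: measurable_funP].
Qed.

(* Indicators are replaced by functions one index at a time: J carries functions
   and K still carries sets. *)
Lemma cond_indep_integral_mixed (h : I -> T -> \bar R) (E : set Omega)
    (J K : seq I) (A : I -> set T) :
  <<s G >> E -> uniq (J ++ K) ->
  (forall i, measurable_fun setT (h i)) -> (forall i x, 0 <= h i x) ->
  (forall i, measurable (A i)) ->
  \int[P]_(w in E `&` \bigcap_(i in [set` K]) (X i @^-1` A i))
    \prod_(i <- J) h i (X i w) =
  P E * \prod_(i <- J) (\int[P]_w h i (X i w)) * \prod_(i <- K) rho (A i).
Proof.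
move=> GE + mh h0.
have mE := GO GE.
have mS (K' : seq I) (A' : I -> set T) : (forall i, measurable (A' i)) ->
    measurable (E `&` \bigcap_(i in [set` K']) (X i @^-1` A' i)).
  move=> mA'; apply: measurableI => //; apply: fin_bigcap_measurable => [|i _].
    by apply/finite_seqP; exists K'.
  exact: measurable_funPTI.
elim: J K A => [K A uK mA|i J IH K A /= /andP[iJK uJK] mA].
  under eq_integral do rewrite big_nil.
  rewrite integral_cst; last exact: mS.
  rewrite mul1e big_nil mule1; apply: (etrans (indep GE uK mA)).
  by rewrite integral_cst// muleC.
pose S := E `&` \bigcap_(j in [set` K]) (X j @^-1` A j).
(* Everything except the function of [X i] is put into a weight. The claim becomes that [X i] has
   the same law under the weight [W1] as under the constant weight [c]. *)
pose W1 := (fun w => \prod_(j <- J) h j (X j w)) \_ S.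
pose c := P E * \prod_(j <- J) (\int[P]_w h j (X j w)) * \prod_(j <- K) rho (A j).
have rho0 B : measurable B -> 0 <= rho B.
  by move=> mB; rewrite -(cond_indep_law i).
have c0 : 0 <= c.
  rewrite !mule_ge0//.
    apply: (big_ind (fun x => 0 <= x)) => // [x y|j _]; first exact: mule_ge0.
    exact: integral_ge0.
  apply: (big_ind (fun x => 0 <= x)) => // [x y|j _]; first exact: mule_ge0.
  exact: rho0.
transitivity (\int[P]_w (h i (X i w) * W1 w)).
  rewrite integral_mkcond; apply: eq_integral => w _.
  rewrite /W1 !patchE; case: ifPn => _; last by rewrite mule0.
  by rewrite big_cons.
transitivity (\int[P]_w (h i (X i w) * cst c w)); last first.
  rewrite /= ge0_integralZr//; last by apply: measurableT_comp.
  by rewrite big_cons /c (muleCA (P E)) -!muleA.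
apply: eq_integral_weighted_law => //.
- apply/(measurable_restrictT _ _).1; first exact: mS.
  by apply: measurable_funTS; exact: measurable_prode_comp.
- by move=> w; apply: erestrict_ge0 => ? _; exact: prode_comp_ge0.
move=> B mB.
rewrite /W1 -integral_mkcondr integral_cst; last exact: measurable_funPTI.
have [iJ iK] : i \notin J /\ i \notin K.
  by move: iJK; rewrite mem_cat negb_or => /andP.
(* Testing on [B] moves [i] from the functions to the sets, which is the induction hypothesis for
   [i :: K] with [B] inserted at [i]. *)
pose A' j := if j == i then B else A j.
have -> : X i @^-1` B `&` S = E `&` \bigcap_(j in [set` i :: K]) (X j @^-1` A' j).
  apply/seteqP; split=> w /=.
    move=> [XB [Ew XA]]; split=> // j /=; rewrite inE /A' => /orP[/eqP->|jK].
      by rewrite eqxx.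
    by case: eqP => [->//|_]; exact: XA.
  move=> [Ew XA]; split; last split=> //.
    by have := XA i (mem_head _ _); rewrite /A' eqxx.
  move=> j /= jK; have := XA j; rewrite /= inE jK orbT => /(_ isT); rewrite /A'.
  by case: eqP => // ji; rewrite -ji jK in iK.
transitivity (c * rho B); last first.
  by congr (_ * _); apply/esym; exact: cond_indep_law.
rewrite IH/=; last 2 first.
- by move: uJK; rewrite !cat_uniq /= (negbTE iJ) iK.
- by move=> j; rewrite /A'; case: ifP.
rewrite big_cons {1}/A' eqxx [LHS]muleCA [RHS]muleC; congr (_ * _).
rewrite /c; congr (_ * _); apply: eq_big_seq => j jK; rewrite /A'.
by case: eqP => // ji; rewrite -ji jK in iK.
Qed.

(** With no set left in [K], the mixed identity says that the product has a constant conditional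
    expectation, and [Y] then replaces the test event. *)
Lemma cond_indep_integral (h : I -> T -> \bar R) (J : seq I)
    (Y : g_sigma_algebraType G -> \bar R) :
  uniq J ->
  (forall i, measurable_fun setT (h i)) -> (forall i x, 0 <= h i x) ->
  measurable_fun setT Y -> (forall w, 0 <= Y w) ->
  \int[P]_w (Y w * \prod_(i <- J) h i (X i w)) =
  (\int[P]_w Y w) * \prod_(i <- J) (\int[P]_w h i (X i w)).
Proof.
move=> uJ mh h0 mY Y0.
set c := \prod_(i <- J) _.
have c0 : 0 <= c.
  apply: (big_ind (fun x => 0 <= x)) => [|x y|i _] //; first exact: mule_ge0.
  exact: integral_ge0.
rewrite -ge0_integralZr//; last first.
  exact: sub_sigma_algebra_measurable_fun.
apply: (eq_integral_sub_sigma_algebra GO (W2 := cst c)) => //.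
- exact: measurable_prode_comp.
- by move=> w; exact: prode_comp_ge0.
move=> E GE.
have := @cond_indep_integral_mixed h E J [::] (fun=> setT) GE.
rewrite cats0 => /(_ uJ mh h0 (fun=> measurableT)).
rewrite big_nil mule1 (_ : [set` [::]] = set0) ?bigcap_set0 ?setIT; last first.
  by apply/seteqP; split.
move=> ->; rewrite integral_cst ?(muleC c)//; exact: GO.
Qed.

End constant_law.

(** * Moments of the Beta(1, a) law *)

Section beta_moments.
Context (R : realType).
Implicit Types (a s x : R).
Local Notation leb := (@lebesgue_measure R).

Lemma is_derive_onem_powR s x : x < 1 ->
  is_derive x 1 (fun y : R => (1 - y) `^ s) (- (s * (1 - x) `^ (s - 1))).
Proof.
move=> x1; have x10 : 0 < 1 - x by rewrite subr_gt0.
have d1 : is_derive x (1:R) (fun y : R => 1 - y) (-1).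
  by apply: is_derive_eq; rewrite add0r mul1r.
rewrite -[X in is_derive _ _ _ X]mulrN1.
exact: (is_derive1_comp (g := fun y : R => 1 - y) (is_derive1_powR s x10) d1).
Qed.

Lemma derivable_onem_powR s x : x < 1 ->
  derivable (fun y : R => (1 - y) `^ s) x 1.
Proof. by move=> x1; have [] := is_derive_onem_powR s x1. Qed.

(** For [s < 1] the integrand is unbounded at 1, so the fundamental theorem is applied on closed
    intervals stopping before 1, followed by a monotone limit. *)
Lemma integral_onem_powR s : 0 < s ->
  (\int[leb]_(x in `]0%R, 1%R[) ((1 - x) `^ (s - 1))%:E = s^-1%:E)%E.
Proof.
move=> s0.
have s0' : s != 0 by rewrite gt_eqF.
have mf (A : set R) : measurable_fun A (fun x => ((1 - x) `^ (s - 1))%:E).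
  apply/measurable_EFinP; apply: measurable_funTS.
  apply: (measurableT_comp (measurable_powR (s - 1))).
  exact: measurable_funB.
rewrite (@integral_itv_obnd_cbnd _ 0 (BLeft 1))//.
(* The shift by 2 makes [b 0] equal to 1/2, so that no interval is degenerate. *)
pose b n : R := 1 - n.+2%:R^-1.
have b01 n : 0 < b n < 1.
  rewrite /b subr_gt0 invf_lt1 ?ltr0n// ltr1n /=.
  by rewrite ltrBlDr ltrDl invr_gt0 ltr0n.
have -> : `[0%R, 1%R[%classic = \bigcup_n `[0%R, b n]%classic.
  apply/seteqP; split=> x /=; rewrite in_itv/=.
    move=> /andP[x0 /ltr_add_invr[k xk]]; exists k => //=.
    rewrite in_itv/= x0 lerBrDr (le_trans _ (ltW xk))// lerD2l.
    by rewrite lef_pV2 ?posrE ?ltr0n// ler_nat.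
  move=> [k _]; rewrite /= in_itv/= => /andP[-> /le_lt_trans]; apply.
  by have /andP[] := b01 k.
have ndb : nondecreasing_seq b.
  by move=> m n mn; rewrite lerB// lef_pV2 ?posrE ?ltr0n// ler_nat ltnS.
have ndI : nondecreasing_seq (fun n => `[0%R, b n]%classic).
  move=> m n mn; apply/subsetPset; apply: subset_itvl; rewrite bnd_simp.
  exact: ndb.
have := @ge0_nondecreasing_set_cvg_integral _ (measurableTypeR R) R (fun n => `[0%R, b n]%classic)
  (fun x => ((1 - x) `^ (s - 1))%:E) leb ndI (fun=> measurable_itv _)
  (fun n => mf _).
have f0 n x : `[0%R, b n]%classic x -> (0 <= ((1 - x) `^ (s - 1))%:E)%E.
  by move=> _; rewrite lee_fin powR_ge0.
move=> /(_ f0) cv.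
apply: (cvg_unique _ cv) => //.
pose F y : R := - ((1 - y) `^ s / s).
have dF x : x < 1 -> is_derive x (1:R) F ((1 - x) `^ (s - 1)).
  move=> x1; have d1 := is_derive_onem_powR s x1.
  rewrite /F; apply: is_derive_eq.
  by rewrite scaler0 add0r scalerN opprK scalerA mulVf// scale1r.
have cF x : x < 1 -> {for x, continuous F}.
  move=> x1; apply: differentiable_continuous; apply/derivable1_diffP.
  by have [] := dF x x1.
have e n : (\int[leb]_(x in `[0%R, b n]) ((1 - x) `^ (s - 1))%:E =
    (s^-1 - n.+2%:R^-1 `^ s / s)%:E)%E.
  have /andP[b0 b1] := b01 n.
  rewrite (@continuous_FTC2 _ _ F)//.
  - by rewrite /F -EFinB opprK addrC subr0 powR1 mul1r /b subKr.
  - apply: derivable_within_continuous => x; rewrite in_itv/= => /andP[_ xb].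
    by apply: derivable_onem_powR; exact: le_lt_trans xb b1.
  - split.
    + move=> x; rewrite in_itv/= => /andP[_ xb].
      by have [] := dF x (lt_trans xb b1).
    + by apply: cvg_at_right_filter; exact: cF.
    + by apply: cvg_at_left_filter; exact: cF.
  - move=> x; rewrite in_itv/= => /andP[_ xb].
    by rewrite derive1E; have [_ ->] := dF x (lt_trans xb b1).
rewrite (_ : (fun n => _) = (fun n => (s^-1 - n.+2%:R^-1 `^ s / s)%:E)); last first.
  by apply/funext => n; exact: e.
apply: cvg_EFin.
  by apply: nearW.
rewrite -[X in _ --> X]subr0 -[X in _ --> _ - X](mul0r s^-1).
apply: cvgB; first exact: cvg_cst.
apply: cvgM; last exact: cvg_cst.
have /cvg_at_rightP := powR_cvg0 s0; apply; split.
  by move=> n; rewrite invr_gt0 ltr0n.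
by rewrite (cvg_shiftS (@harmonic R)); exact: cvg_harmonic.
Qed.

Lemma beta_norm_1 a : 0 < a -> beta_norm 1 a = a^-1.
Proof.
move=> a0; rewrite /beta_norm /Rintegral.
under eq_integral do rewrite /beta_kernel subrr powRr0 mul1r.
by rewrite integral_onem_powR.
Qed.

Lemma measurable_onem_powR s (D : set R) :
  measurable_fun D (fun x => (1 - x) `^ s).
Proof.
apply: measurable_funTS; apply: (measurableT_comp (measurable_powR s)).
exact: measurable_funB.
Qed.

Local Open Scope ereal_scope.

Context d (Omega : measurableType d) (P : probability Omega R).
Variables (a : R) (a0 : (0 < a)%R) (psi : {RV P >-> R}).
Hypothesis psi_beta : forall A, measurable A -> P (psi @^-1` A) = beta_law 1 a A.

Lemma ge0_integral_beta (h : R -> \bar R) :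
  measurable_fun setT h -> (forall x, 0 <= h x) ->
  \int[P]_w h (psi w) =
  \int[leb]_(x in `]0%R, 1%R[) (h x * (a * (1 - x) `^ (a - 1))%:E).
Proof.
move=> mh h0.
pose W := (fun x => (a * (1 - x) `^ (a - 1))%:E) \_ `]0%R, 1%R[%classic.
have mw (D : set R) : measurable_fun D (fun x => (a * (1 - x) `^ (a - 1))%:E).
  apply/measurable_EFinP; apply: measurable_funM => //.
  exact: measurable_onem_powR.
transitivity (\int[P]_w (h (psi w) * cst 1 w)).
  by apply: eq_integral => w _; rewrite /= mule1.
rewrite (@eq_integral_weighted_law _ _ _ _ _ _ (measurableTypeR R) P leb psi id
  (cst 1) W)//.
- rewrite [RHS]integral_mkcond; apply: eq_integral => x _.
  by rewrite /W !patchE; case: ifPn => // _; rewrite mule0.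
- by apply/(measurable_restrictT _ _).1; [exact: measurable_itv|exact: mw].
- move=> x; apply: erestrict_ge0 => y _; rewrite lee_fin mulr_ge0 ?powR_ge0//.
  exact: ltW.
- move=> A mA; rewrite integral_cst; last exact: measurable_funPTI.
  rewrite mul1e; apply: (etrans (psi_beta mA)).
  rewrite /W -integral_mkcondr /beta_law; apply: eq_integral => x _.
  by rewrite beta_norm_1// /beta_kernel subrr powRr0 mul1r invrK mulrC.
Qed.

Lemma ae_beta_itv : {ae P, forall w, (0 < psi w < 1)%R}.
Proof.
exists (psi @^-1` (~` `]0%R, 1%R[)); split.
- by apply: measurable_funPTI; exact: measurableC.
- apply: (etrans (psi_beta _)); first exact: measurableC.
  by rewrite /beta_law setIC setICr integral_set0.
- by move=> w /= /negP; rewrite in_itv/= => /negP.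
Qed.

(** Powers of 1 - x are absorbed by the density a (1 - x)^(a - 1), which leaves [integral_onem_powR]
    at [a + n]. The absolute value keeps the integrand nonnegative on the null event where the stick
    exceeds 1. *)
Lemma beta_moment_onem n :
  \int[P]_w (`|1 - psi w| ^+ n)%:E = (a / (a + n%:R))%:E.
Proof.
rewrite (ge0_integral_beta (h := fun x => (`|1 - x| ^+ n)%:E)); last 2 first.
- apply/measurable_EFinP; apply: measurable_funX; apply: measurableT_comp => //.
  exact: measurable_funB.
- by move=> x; rewrite lee_fin exprn_ge0.
have an0 : (0 < a + n%:R)%R by rewrite ltr_wpDr.
transitivity (\int[leb]_(x in `]0%R, 1%R[)
    (a%:E * ((1 - x) `^ (a + n%:R - 1))%:E)).
  apply: eq_integral => x; rewrite inE/= in_itv/= => /andP[x0 x1].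
  have x10 : (0 < 1 - x)%R by rewrite subr_gt0.
  rewrite -!EFinM; congr EFin; rewrite mulrCA; congr (_ * _)%R.
  rewrite gtr0_norm// -powR_mulrn ?ltW// -powRD; last first.
    by rewrite (gt_eqF x10) implybT.
  by rewrite addrCA addrA.
rewrite ge0_integralZl_EFin//.
- by rewrite integral_onem_powR.
- by move=> x _; rewrite lee_fin powR_ge0.
- by apply/measurable_EFinP; exact: measurable_onem_powR.
- exact: ltW.
Qed.

(* On ]0, 1[, x^2 + 2 (1 - x) = 1 + (1 - x)^2. *)
Lemma beta_moment2 :
  \int[P]_w (psi w ^+ 2)%:E = (2 / ((a + 1) * (a + 2)))%:E.
Proof.
have e : \int[P]_w (psi w ^+ 2)%:E + 2%:E * \int[P]_w (`|1 - psi w| ^+ 1)%:E =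
    1 + \int[P]_w (`|1 - psi w| ^+ 2)%:E.
  have m1 n : measurable_fun setT (fun w => (`|1 - psi w| ^+ n)%:E).
    apply/measurable_EFinP; apply: measurable_funX; apply: measurableT_comp => //.
    exact: measurable_funB.
  have m2 : measurable_fun setT (fun w => (psi w ^+ 2)%:E).
    by apply/measurable_EFinP; exact: measurable_funX.
  transitivity (\int[P]_w ((psi w ^+ 2)%:E + 2%:E * (`|1 - psi w| ^+ 1)%:E)).
    rewrite ge0_integralD//.
    - by rewrite ge0_integralZl_EFin.
    - by move=> w _; rewrite lee_fin sqr_ge0.
    - exact: measurable_funeM.
  transitivity (\int[P]_w (1 + (`|1 - psi w| ^+ 2)%:E)); last first.
    by rewrite ge0_integralD// integral_probability_cst.
  apply: ge0_ae_eq_integral => //.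
  - by apply: emeasurable_funD => //; exact: measurable_funeM.
  - exact: emeasurable_funD.
  - by move=> w _; rewrite adde_ge0 ?mule_ge0 ?lee_fin ?sqr_ge0 ?exprn_ge0.
  - by move=> w _; rewrite adde_ge0 ?lee_fin ?exprn_ge0.
  apply: filterS ae_beta_itv => w /andP[w0 w1] _ /=.
  rewrite ger0_norm ?subr_ge0 ?ltW// -EFinM -!EFinD; congr EFin.
  by ring.
move: e; rewrite !beta_moment_onem.
(* The unknown moment must be finite, since adding a finite number to it gives a finite number. *)
case: (\int[P]_w _) => [r| |]//.
rewrite -EFinM -!EFinD => -[e]; congr EFin.
have a1 : (a + 1 != 0)%R by rewrite gt_eqF// addr_gt0.
have a2 : (a + 2 != 0)%R by rewrite gt_eqF// addr_gt0.
rewrite -(addrK (2 * (a / (a + 1))) r)%R e.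
by field; rewrite a1 a2.
Qed.

End beta_moments.

(** * Stick-breaking weights and series over atoms *)

Lemma measurable_stick_weight d (T : measurableType d) (R : realType)
    (psi : nat -> T -> R) (k : nat) :
  (forall t, measurable_fun setT (psi t)) -> measurable_fun setT (stick_weight psi k).
Proof.
move=> mpsi; apply: measurable_funM; first exact: mpsi.
by apply: measurable_prod => t _; apply: measurable_funB.
Qed.

Section stick_weights.
Context (R : realType) d (Omega : measurableType d) (P : probability Omega R).
Variables (G : set (set Omega)) (a : R) (psi : nat -> {RV P >-> R}).
Hypothesis GO : <<s G >> `<=` measurable.
Hypothesis a0 : 0 < a.
Hypothesis indep : cond_indep <<s G >> (fun _ _ => beta_law 1 a) psi.

(* Nonnegative everywhere, and almost surely equal to the stick-breaking weight. *)
Definition abs_stick (k : nat) (w : Omega) : R := `|stick_weight psi k w|.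

(** The weight of index [k] is padded with factors 1 beyond [k]. Two weights of different indices
    then become products over the same range of sticks and multiply factor by factor. *)
Let factor (k t : nat) (x : R) : R :=
  if (t < k)%N then `|1 - x| else if t == k then `|x| else 1.

Let abs_stickE k N w : (k < N)%N ->
  abs_stick k w = \prod_(0 <= t < N) factor k t (psi t w).
Proof.
move=> kN; rewrite (big_cat_nat (n := k)) ?(ltnW kN)//= (big_ltn kN).
have -> : \prod_(k.+1 <= t < N) factor k t (psi t w) = 1.
  rewrite big_nat big1// => t /andP[kt _].
  by rewrite /factor ltnNge (ltnW kt)/= gtn_eqF.
rewrite mulr1.
rewrite /abs_stick /stick_weight normrM mulrC normr_prod.
rewrite -(big_mkord xpredT (fun t => `|1 - psi t w|)) /=.
rewrite {2}/factor ltnn eqxx; congr (_ * _).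
by apply: eq_big_nat => t /andP[_ tk]; rewrite /factor tk.
Qed.

Local Open Scope ereal_scope.

Lemma abs_stick_ge0 k w : 0 <= (abs_stick k w)%:E.
Proof. by rewrite lee_fin /abs_stick. Qed.

Let measurable_factor k t : measurable_fun setT (factor k t).
Proof.
rewrite /factor; case: (t < k)%N.
  by apply: measurableT_comp => //; exact: measurable_funB.
by case: (t == k).
Qed.

Lemma measurable_abs_stick k : measurable_fun setT (fun w => (abs_stick k w)%:E).
Proof.
apply/measurable_EFinP; apply: measurableT_comp => //.
by apply: measurable_stick_weight => t; exact: measurable_funP.
Qed.

Let factor2_ge0 k l t x : 0 <= (factor k t x * factor l t x)%:E.
Proof.
by rewrite lee_fin mulr_ge0// /factor; case: ifP => // _; case: ifP.
Qed.

Let integral_abs_stickM_prod k l N (Y : g_sigma_algebraType G -> \bar R) :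
  (k < N)%N -> (l < N)%N ->
  measurable_fun setT Y -> (forall w, 0 <= Y w) ->
  \int[P]_w (Y w * ((abs_stick k w)%:E * (abs_stick l w)%:E)) =
  (\int[P]_w Y w) *
    \prod_(0 <= t < N) (\int[P]_w (factor k t (psi t w) * factor l t (psi t w))%:E).
Proof.
move=> kN lN mY Y0.
rewrite -(cond_indep_integral GO indep
  (h := fun t x => (factor k t x * factor l t x)%:E))//; last 2 first.
- exact: iota_uniq.
- move=> t; apply/measurable_EFinP; exact: measurable_funM.
apply: eq_integral => w _; congr (_ * _).
rewrite (abs_stickE _ kN) (abs_stickE _ lN) -EFinM -big_split/=.
by elim/big_rec2 : _ => // t x y _ IH; rewrite EFinM IH.
Qed.

(** Decouples the weights from the conditioning sigma-field: with [Y] and with the constant 1, the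
    integral is the same product of one-stick moments, up to the factor given by the integral of
    [Y]. *)
Lemma integral_abs_stickM (k l : nat) (Y : g_sigma_algebraType G -> \bar R) :
  measurable_fun setT Y -> (forall w, 0 <= Y w) ->
  \int[P]_w (Y w * ((abs_stick k w)%:E * (abs_stick l w)%:E)) =
  (\int[P]_w Y w) * \int[P]_w ((abs_stick k w)%:E * (abs_stick l w)%:E).
Proof.
move=> mY Y0.
have kN : (k < (maxn k l).+1)%N by rewrite ltnS leq_maxl.
have lN : (l < (maxn k l).+1)%N by rewrite ltnS leq_maxr.
rewrite (integral_abs_stickM_prod kN lN)//; congr (_ * _).
transitivity (\int[P]_w (cst 1 w * ((abs_stick k w)%:E * (abs_stick l w)%:E))).
  by rewrite (integral_abs_stickM_prod kN lN)// integral_probability_cst mul1e.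
by apply: eq_integral => w _; rewrite /= mul1e.
Qed.

(** By independence the term of index k is E psi^2 times the k-th power of E (1 - psi)^2, that is
    [e * b ^+ k]. As 1 - b = 2 / (a + 2), the geometric series sums to [e / (1 - b)], which is 1 /
    (1 + a). *)
Lemma nneseries_abs_stick2 :
  \sum_(0 <= k <oo) \int[P]_w ((abs_stick k w)%:E * (abs_stick k w)%:E) =
  ((1 + a)^-1)%:E.
Proof.
have law t A : measurable A -> P (psi t @^-1` A) = beta_law 1 a A.
  exact: (cond_indep_law indep).
pose b := (a / (a + 2))%R; pose e := (2 / ((a + 1) * (a + 2)))%R.
have ek k : \int[P]_w ((abs_stick k w)%:E * (abs_stick k w)%:E) =
    (e * b ^+ k)%:E.
  transitivity (\int[P]_w (cst 1 w * ((abs_stick k w)%:E * (abs_stick k w)%:E))).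
    by apply: eq_integral => w _; rewrite /= mul1e.
  rewrite (integral_abs_stickM_prod (ltnSn k) (ltnSn k))//.
  rewrite integral_probability_cst mul1e big_nat_recr//=.
  rewrite {3 4}/factor ltnn eqxx.
  under [X in _ * X]eq_integral do rewrite -normrM -expr2 ger0_norm ?sqr_ge0//.
  rewrite (beta_moment2 a0 (law k)) [LHS]muleC [RHS]EFinM; congr (_ * _).
  rewrite (@eq_big_nat _ _ _ 0%N k _ (fun=> b%:E)); last first.
    move=> t /andP[_ tk]; rewrite -(beta_moment_onem a0 (law t) 2).
    by apply: eq_integral => w _; rewrite /factor tk expr2.
  elim: (k) => [|n IH]; first by rewrite big_nil expr0.
  by rewrite big_nat_recr//= IH exprSr EFinM.
under eq_eseriesr do rewrite ek.
have a1 : (1 + a != 0)%R by rewrite gt_eqF// addr_gt0.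
have a2 : (a + 2 != 0)%R by rewrite gt_eqF// addr_gt0.
have b1 : (`|b| < 1)%R.
  rewrite ger0_norm ?divr_ge0 ?addr_ge0 ?ltW//.
  by rewrite ltr_pdivrMr ?addr_gt0// mul1r ltrDl.
have -> : ((1 + a)^-1 = e * (1 - b)^-1)%R.
  rewrite /e /b; field.
  by rewrite a2 (addrC a) addrK pnatr_eq0/= -(addrC 1%R).
apply/cvg_lim => //.
rewrite (_ : (fun n => _) = EFin \o series (geometric e b)); last first.
  by apply/funext => n; rewrite /= /series/= sumEFin.
by apply: cvg_EFin; [exact: nearW|exact: cvg_geometric_series].
Qed.

Lemma ae_stick_weight_ge0 :
  {ae P, forall w k, abs_stick k w = stick_weight psi k w}.
Proof.
have law t A : measurable A -> P (psi t @^-1` A) = beta_law 1 a A.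
  exact: (cond_indep_law indep).
have H t : {ae P, forall w, (0 < psi t w < 1)%R}.
  exact: (ae_beta_itv (law t)).
have : {ae P, forall w t, (0 < psi t w < 1)%R}.
  apply/ae_foralln => t. exact: H.
apply: filterS => w w01 k; rewrite /abs_stick ger0_norm//.
rewrite /stick_weight mulr_ge0//.
  by have /andP[/ltW] := w01 k.
by rewrite prodr_ge0// => t _; rewrite subr_ge0; have /andP[_ /ltW] := w01 t.
Qed.

End stick_weights.

(** * Nonnegative double series and their diagonals *)

Section series_products.
Local Open Scope ereal_scope.
Context (R : realType).

Lemma ge0_nneseriesZl (f : nat -> \bar R) (x : \bar R) :
  (forall k, 0 <= f k) -> 0 <= x ->
  \sum_(0 <= k <oo) (x * f k) = x * \sum_(0 <= k <oo) f k.
Proof.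
move=> f0 x0; rewrite -!ge0_integral_count//; last by move=> k; exact: mule_ge0.
by rewrite ge0_integralZl.
Qed.

Lemma ge0_nneseriesZr (f : nat -> \bar R) (x : \bar R) :
  (forall k, 0 <= f k) -> 0 <= x ->
  \sum_(0 <= k <oo) (f k * x) = (\sum_(0 <= k <oo) f k) * x.
Proof.
move=> f0 x0; rewrite [RHS]muleC -ge0_nneseriesZl//.
by apply: eq_eseriesr => k _; rewrite muleC.
Qed.

Context d (Omega : measurableType d) (mu : {measure set Omega -> \bar R}).

Lemma ge0_integral_nneseriesZ (f : nat -> Omega -> \bar R) (S : Omega -> \bar R) :
  (forall k, measurable_fun setT (f k)) -> measurable_fun setT S ->
  (forall k w, 0 <= f k w) -> (forall w, 0 <= S w) ->
  \int[mu]_w ((\sum_(0 <= k <oo) f k w) * S w) =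
  \sum_(0 <= k <oo) \int[mu]_w (f k w * S w).
Proof.
move=> mf mS f0 S0.
rewrite -integral_nneseries//; last 2 first.
- by move=> k; exact: emeasurable_funM.
- by move=> k w _; exact: mule_ge0.
by apply: eq_integral => w _; rewrite ge0_nneseriesZr.
Qed.

Lemma measurable_fun_nneseries (f : nat -> Omega -> \bar R) :
  (forall k, measurable_fun setT (f k)) -> (forall k w, 0 <= f k w) ->
  measurable_fun setT (fun w => \sum_(0 <= k <oo) f k w).
Proof. by move=> mf f0; apply: ge0_emeasurable_sum => // k w _ _; exact: f0. Qed.

Lemma ge0_integral_nneseriesM (f g : nat -> Omega -> \bar R) :
  (forall k, measurable_fun setT (f k)) -> (forall k, measurable_fun setT (g k)) ->
  (forall k w, 0 <= f k w) -> (forall k w, 0 <= g k w) ->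
  \int[mu]_w ((\sum_(0 <= k <oo) f k w) * \sum_(0 <= l <oo) g l w) =
  \sum_(0 <= k <oo) \sum_(0 <= l <oo) \int[mu]_w (f k w * g l w).
Proof.
move=> mf mg f0 g0.
rewrite ge0_integral_nneseriesZ//; last 2 first.
- exact: measurable_fun_nneseries.
- by move=> w; exact: nneseries_ge0.
apply: eq_eseriesr => k _.
under eq_integral do rewrite muleC.
rewrite ge0_integral_nneseriesZ//.
by apply: eq_eseriesr => l _; apply: eq_integral => w _; rewrite muleC.
Qed.

(** The off-diagonal mass is deduced from the total mass. To avoid subtracting extended reals, the
    diagonal term is exchanged by addition: each row plus [p k k * z2] equals the row with constant
    value [z2] plus [p k k * z1]. *)
Lemma nneseries_diagonal (p : nat -> nat -> \bar R) (c z1 z2 : R) :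
  (forall k l, 0 <= p k l) ->
  \sum_(0 <= k <oo) \sum_(0 <= l <oo) p k l = 1 ->
  \sum_(0 <= k <oo) p k k = c%:E ->
  (0 <= z1)%R -> (0 <= z2)%R ->
  \sum_(0 <= k <oo) \sum_(0 <= l <oo) (p k l * (if k == l then z1 else z2)%:E) =
  (c * z1 + (1 - c) * z2)%:E.
Proof.
move=> p0 p1 pc z10 z20.
pose z (k l : nat) : R := if k == l then z1 else z2.
have z0 k l : 0 <= (z k l)%:E by rewrite lee_fin /z; case: ifP.
have pz0 k l : 0 <= p k l * (z k l)%:E by exact: mule_ge0.
have pzi0 k l x : (0 <= x)%R -> 0 <= p k l * x%:E.
  by move=> x0; rewrite mule_ge0.
have row k : \sum_(0 <= l <oo) (p k l * (z k l)%:E) + p k k * z2%:E =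
    \sum_(0 <= l <oo) (p k l * z2%:E) + p k k * z1%:E.
  rewrite (nneseriesD1 (n := k))//.
  rewrite [in RHS](nneseriesD1 (n := k))//; last by move=> *; exact: pzi0.
  rewrite {1}/z eqxx addeAC [RHS]addeAC; congr (_ + _); last first.
    by apply: eq_eseriesr => l /andP[_ lk]; rewrite /z eq_sym (negbTE lk).
  by rewrite addeC.
have : \sum_(0 <= k <oo) (\sum_(0 <= l <oo) (p k l * (z k l)%:E) + p k k * z2%:E)
    = \sum_(0 <= k <oo) (\sum_(0 <= l <oo) (p k l * z2%:E) + p k k * z1%:E).
  by apply: eq_eseriesr => k _; exact: row.
rewrite nneseriesD; last 2 first.
- by move=> k _ _; apply: nneseries_ge0.
- by move=> k _ _; exact: pzi0.
rewrite nneseriesD; last 2 first.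
- by move=> k _ _; apply: nneseries_ge0 => l _ _; exact: pzi0.
- by move=> k _ _; exact: pzi0.
rewrite !ge0_nneseriesZr//.
under [X in _ = X + _ -> _]eq_eseriesr do rewrite ge0_nneseriesZr//.
rewrite ge0_nneseriesZr//; last by move=> k; exact: nneseries_ge0.
rewrite p1 pc mul1e -!EFinM -EFinD.
case: (\sum_(0 <= k <oo) _) => [r| |]//=.
by rewrite -EFinD => -[e]; congr EFin; rewrite -[LHS](addrK (c * z2)%R) e; ring.
Qed.

End series_products.

Section mixture.
Local Open Scope ereal_scope.
Context (R : realType) d (Omega : measurableType d) (P : probability Omega R).

(** Here [p k l] of the diagonal lemma is the integral of [v k * v l]; its total is 1 because the
    square of the sum of the weights is almost surely 1. The last hypothesis is the decoupling of
    the weights from what sits at the atoms. *)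
Lemma integral_mixture (v f g : nat -> Omega -> \bar R) (c z1 z2 : R) :
  (forall k, measurable_fun setT (v k)) ->
  (forall k, measurable_fun setT (f k)) -> (forall k, measurable_fun setT (g k)) ->
  (forall k w, 0 <= v k w) -> (forall k w, 0 <= f k w) -> (forall k w, 0 <= g k w) ->
  {ae P, forall w, \sum_(0 <= k <oo) v k w = 1} ->
  \sum_(0 <= k <oo) \int[P]_w (v k w * v k w) = c%:E ->
  (0 <= z1)%R -> (0 <= z2)%R ->
  (forall k l, \int[P]_w ((f k w * g l w) * (v k w * v l w)) =
    \int[P]_w (v k w * v l w) * (if k == l then z1 else z2)%:E) ->
  \int[P]_w ((\sum_(0 <= k <oo) v k w * f k w) * \sum_(0 <= l <oo) v l w * g l w) =
  (c * z1 + (1 - c) * z2)%:E.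
Proof.
move=> mv mf mg v0 f0 g0 v1 vc z10 z20 fg.
rewrite ge0_integral_nneseriesM; last 4 first.
- by move=> k; exact: emeasurable_funM.
- by move=> k; exact: emeasurable_funM.
- by move=> k w; exact: mule_ge0.
- by move=> k w; exact: mule_ge0.
transitivity (\sum_(0 <= k <oo) \sum_(0 <= l <oo)
    (\int[P]_w (v k w * v l w) * (if k == l then z1 else z2)%:E)).
  apply: eq_eseriesr => k _; apply: eq_eseriesr => l _; rewrite -fg.
  by apply: eq_integral => w _; rewrite muleACA muleC.
apply: nneseries_diagonal => //.
- by move=> k l; apply: integral_ge0 => w _; exact: mule_ge0.
rewrite -ge0_integral_nneseriesM//.
rewrite -[RHS](integral_probability_cst P 1).
apply: ge0_ae_eq_integral => //.
- by apply: emeasurable_funM; exact: measurable_fun_nneseries.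
- by move=> w _; apply: mule_ge0; exact: nneseries_ge0.
by apply: filterS v1 => w -> _; rewrite mule1.
Qed.

End mixture.

(** * Second moments of Dirichlet processes *)

Section sigma_of.
Context d (Omega : measurableType d) d' (T : measurableType d') (I : Type).
Variable X : I -> Omega -> T.

Lemma sigma_of_sub_measurable :
  (forall i, measurable_fun setT (X i)) -> sigma_of X `<=` measurable.
Proof.
move=> mX; apply: smallest_sub; first exact: sigma_algebra_measurable.
by move=> _ [i _ [B mB <-]]; exact: mX.
Qed.

Lemma sigma_of_preimage i B : measurable B -> sigma_of X (X i @^-1` B).
Proof.
move=> mB; apply: sub_sigma_algebra; exists i => //.
by exists B => //; rewrite setTI.
Qed.

End sigma_of.

Section cond_indep_pairs.
Local Open Scope ereal_scope.
Context (R : realType) d (Omega : measurableType d) (P : probability Omega R).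
Context d' (T : measurableType d') (I : eqType).
Variable (G : set (set Omega)).
Hypothesis GO : <<s G >> `<=` measurable.
Variables (L : I -> Omega -> probability T R) (X : I -> {RV P >-> T}).
Hypothesis mL : forall i A, measurable A -> measurable_fun setT (fun w => L i w A).
Hypothesis indep : cond_indep <<s G >> (fun i w => L i w) X.

Let mX i A : measurable A ->
  measurable_fun setT (fun w => (\1_A (X i w))%:E : \bar R).
Proof.
move=> mA; apply/measurable_EFinP.
by apply: (measurableT_comp (measurable_indic mA)); exact: measurable_funP.
Qed.

(** Here and in the two-variable version, [Y] will carry the stick weights, so the law [L] may be
    random as long as the weights belong to the conditioning sigma-field. *)
Lemma cond_indep_integral1 i A (Y : g_sigma_algebraType G -> \bar R) :
  measurable A -> measurable_fun setT Y -> (forall w, 0 <= Y w) ->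
  \int[P]_w (Y w * (\1_A (X i w))%:E) = \int[P]_w (Y w * L i w A).
Proof.
move=> mA mY Y0; apply: (eq_integral_sub_sigma_algebra GO) => //.
- exact: mX.
- exact: mL.
move=> E GE.
have := indep GE (isT : uniq [:: i]) (fun _ => mA).
rewrite (_ : [set` [:: i]] = [set i]); last first.
  by apply/seteqP; split=> j /=; rewrite inE => /eqP.
rewrite bigcap_set1.
under [X in _ = X -> _]eq_integral do rewrite big_seq1.
move=> <-; rewrite -[LHS]/(\int[P]_(w in E) (\1_(X i @^-1` A) w)%:E).
rewrite integral_indic//; [by rewrite setIC|exact: GO|exact: measurable_funPTI].
Qed.

Lemma cond_indep_integral2 i j A B (Y : g_sigma_algebraType G -> \bar R) :
  i != j -> measurable A -> measurable B ->
  measurable_fun setT Y -> (forall w, 0 <= Y w) ->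
  \int[P]_w (Y w * ((\1_A (X i w))%:E * (\1_B (X j w))%:E)) =
  \int[P]_w (Y w * (L i w A * L j w B)).
Proof.
move=> ij mA mB mY Y0; apply: (eq_integral_sub_sigma_algebra GO) => //.
- by apply: emeasurable_funM; exact: mX.
- by apply: emeasurable_funM; exact: mL.
- by move=> w; rewrite mule_ge0.
move=> E GE.
have u : uniq [:: i; j] by rewrite /= inE ij.
pose C k := if k == i then A else B.
have mC k : measurable (C k) by rewrite /C; case: ifP.
have := indep GE u mC.
rewrite (_ : \bigcap_(_ in _) _ = X i @^-1` A `&` X j @^-1` B); last first.
  apply/seteqP; split=> w /=.
    move=> XC; split.
      by have := XC i (mem_head _ _); rewrite /C eqxx.
    by have := XC j; rewrite /C /= !inE eqxx orbT eq_sym (negbTE ij); exact.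
  move=> [Aw Bw] k /=; rewrite !inE => /orP[]/eqP->; rewrite /C ?eqxx//.
  by rewrite eq_sym (negbTE ij).
under [X in _ = X -> _]eq_integral do rewrite big_cons big_seq1 /C eqxx eq_sym (negbTE ij).
move=> <-.
rewrite (_ : (fun w => _) = fun w => (\1_(X i @^-1` A `&` X j @^-1` B) w)%:E).
  rewrite integral_indic//; [by rewrite setIC|exact: GO|].
  by apply: measurableI; exact: measurable_funPTI.
by apply/funext => w; rewrite indicI EFinM.
Qed.

End cond_indep_pairs.

Lemma measurable_pprobability d0 (T0 : measurableType d0) d (T : measurableType d)
    (R : realType) (Q : T0 -> pprobability T R) (A : set T) :
  measurable_fun setT Q -> measurable A ->
  measurable_fun setT (fun w => (Q w : probability T R) A).
Proof.
by move=> mQ mA; exact: (measurable_kernel (kprobability mQ) A mA).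
Qed.

Lemma cond_indep_pair (R : realType) d (Omega : measurableType d)
    (P : probability Omega R) d' (T : measurableType d') (I : eqType)
    (F : set (set Omega)) (rho : set T -> \bar R)
    (X : I * nat -> {RV P >-> T}) (i : I) :
  cond_indep F (fun _ _ => rho) X ->
  cond_indep F (fun _ _ => rho) (fun k => X (i, k)).
Proof.
move=> indep E J A FE uJ mA.
have uJ' : uniq [seq (i, k) | k <- J].
  by rewrite map_inj_uniq// => k l [].
have := indep E _ (fun r => A r.2) FE uJ' (fun r => mA r.2).
rewrite (_ : \bigcap_(r in _) _ = \bigcap_(k in [set` J]) (X (i, k) @^-1` A k)).
  move=> ->; apply: eq_integral => w _; by rewrite big_map.
apply/seteqP; split=> w /= XA.
  by move=> k /= kJ; exact: (XA (i, k) (map_f _ kJ)).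
by move=> _ /mapP[k kJ ->]; exact: XA.
Qed.

Section stick_breaking_series.
Local Open Scope ereal_scope.
Context (R : realType) d (Omega : measurableType d) (P : probability Omega R).
Context d' (T : measurableType d') (G : set (set Omega)) (a : R).
Variables (psi : nat -> {RV P >-> R}) (theta : nat -> Omega -> T).
Variable (X : Omega -> probability T R).
Hypothesis indep : cond_indep <<s G >> (fun _ _ => beta_law 1 a) psi.
Hypothesis XE : stick_breaking P psi theta X.

Lemma stick_breaking_abs : {ae P, forall w, forall A, measurable A ->
  X w A = \sum_(0 <= k <oo) (abs_stick psi k w)%:E * (\1_A (theta k w))%:E}.
Proof.
apply: filterS2 XE (ae_stick_weight_ge0 indep) => w XA psi_ge0 A mA.
by rewrite XA//; apply: eq_eseriesr => k _; rewrite psi_ge0 diracE indicE.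
Qed.

Lemma ae_sum_abs_stick :
  {ae P, forall w, \sum_(0 <= k <oo) (abs_stick psi k w)%:E = 1}.
Proof.
apply: filterS stick_breaking_abs => w XA.
rewrite -(probability_setT (X w)) XA//; apply: eq_eseriesr => k _.
by rewrite indicT mule1.
Qed.

End stick_breaking_series.

Section iid_DP_moments.
Local Open Scope ereal_scope.
Context (R : realType) d (Omega : measurableType d) (P : probability Omega R).
Context d' (T : measurableType d') (I : eqType).
Variables (F : set (set Omega)) (a : R) (P0 : Omega -> probability T R).
Variable (X : I -> {RV P >-> pprobability T R}).
Hypothesis F_sigma : sigma_algebra setT F.
Hypothesis F_sub : F `<=` measurable.
Hypothesis P0_F : forall A, measurable A ->
  measurable_fun setT (fun w : g_sigma_algebraType F => P0 w A).
Hypothesis a0 : (0 < a)%R.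
Hypothesis X_DP : iid_DP F a P0 X.

Let F_gen : <<s F >> = F. Proof. exact: sigma_algebra_id. Qed.

Let FO : <<s F >> `<=` measurable. Proof. by rewrite F_gen. Qed.

Local Notation val i w A := ((X i w : probability T R) A).

Let mval i A : measurable A -> measurable_fun setT (fun w => val i w A).
Proof. by move=> mA; apply: measurable_pprobability. Qed.

Let mP0 A : measurable A -> measurable_fun setT (fun w => P0 w A).
Proof. by move=> mA; exact: (sub_sigma_algebra_measurable_fun FO (P0_F mA)). Qed.

Let val_ge0 i w A : 0 <= val i w A. Proof. exact: measure_ge0. Qed.

Section sticks_and_atoms.
Variables (psi : I * nat -> {RV P >-> R}) (theta : I * nat -> {RV P >-> T}).
Hypothesis psi_indep : cond_indep F (fun _ _ => beta_law 1 a) psi.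
Hypothesis theta_indep :
  cond_indep <<s F `|` sigma_of psi >> (fun _ w => P0 w) theta.
Hypothesis XE : forall i, stick_breaking P (fun k => psi (i, k))
  (fun k => theta (i, k)) (X i).

Let psiF i : cond_indep <<s F >> (fun _ _ => beta_law 1 a) (fun k => psi (i, k)).
Proof. by rewrite F_gen; exact: cond_indep_pair. Qed.

Let G := F `|` sigma_of psi.

Let GO : <<s G >> `<=` measurable.
Proof.
apply: smallest_sub; first exact: sigma_algebra_measurable.
move=> A [/F_sub//|]; apply: sigma_of_sub_measurable => p.
exact: measurable_funP.
Qed.

Let v i k w : \bar R := (abs_stick (fun k => psi (i, k)) k w)%:E.

Let v_ge0 i k w : 0 <= v i k w. Proof. exact: abs_stick_ge0. Qed.

Let mv i k : measurable_fun setT (v i k).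
Proof. exact: measurable_abs_stick. Qed.

(** Measurability is required for the smaller sigma-field [<<s G>>], since the weights act as test
    functions when the atoms are integrated out. *)
Let v_G i k : measurable_fun setT (v i k : g_sigma_algebraType G -> \bar R).
Proof.
apply/measurable_EFinP; apply: measurableT_comp => //.
apply: (@measurable_stick_weight _ (g_sigma_algebraType G)) => t.
move=> _ A mA; rewrite setTI; apply: sub_sigma_algebra; right.
exact: sigma_of_preimage.
Qed.

Let ind i k A w : \bar R := (\1_A (theta (i, k) w))%:E.

Let ind_ge0 i k A w : 0 <= ind i k A w. Proof. by rewrite lee_fin. Qed.

Let mind i k A : measurable A -> measurable_fun setT (ind i k A).
Proof.
move=> mA; apply/measurable_EFinP.
by apply: (measurableT_comp (measurable_indic mA)); exact: measurable_funP.
Qed.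

Let ae_val i : {ae P, forall w, forall A, measurable A ->
  val i w A = \sum_(0 <= k <oo) v i k w * ind i k A w}.
Proof. exact: (stick_breaking_abs (psiF i) (XE i)). Qed.

Let integral_val i j A B : measurable A -> measurable B ->
  \int[P]_w (val i w A * val j w B) =
  \int[P]_w ((\sum_(0 <= k <oo) v i k w * ind i k A w) *
              (\sum_(0 <= l <oo) v j l w * ind j l B w)).
Proof.
move=> mA mB; apply: ge0_ae_eq_integral => //.
- by apply: emeasurable_funM; exact: mval.
- apply: emeasurable_funM; apply: measurable_fun_nneseries => k //.
  + by apply: emeasurable_funM => //; exact: mind.
  + by move=> w; exact: mule_ge0.
  + by apply: emeasurable_funM => //; exact: mind.
  + by move=> w; exact: mule_ge0.
- by move=> w _; exact: mule_ge0.
- move=> w _; apply: mule_ge0; apply: nneseries_ge0 => k _ _; exact: mule_ge0.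
by apply: filterS2 (ae_val i) (ae_val j) => w iE jE _; rewrite iE// jE.
Qed.

Let P0_ge0 w A : 0 <= P0 w A. Proof. exact: measure_ge0. Qed.

(** Given [F] and the sticks, atoms with distinct labels are independent with law [P0]. The case
    [i = j], [k != l] gives the off-diagonal terms of one process, and [i != j] all the terms of two
    processes. *)
Let integral_ind_diff i j k l A B : (i, k) != (j, l) ->
  measurable A -> measurable B ->
  \int[P]_w ((ind i k A w * ind j l B w) * (v i k w * v j l w)) =
  \int[P]_w ((P0 w A * P0 w B) * (v i k w * v j l w)).
Proof.
move=> kl mA mB.
under eq_integral do rewrite muleC.
under [RHS]eq_integral do rewrite muleC.
apply: (cond_indep_integral2 GO (L := fun _ => P0) _ theta_indep) => //.
- by apply: emeasurable_funM; exact: v_G.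
- by move=> w; exact: mule_ge0.
Qed.

Let integral_ind_same i k A B : measurable A -> measurable B ->
  \int[P]_w ((ind i k A w * ind i k B w) * (v i k w * v i k w)) =
  \int[P]_w (P0 w (A `&` B) * (v i k w * v i k w)).
Proof.
move=> mA mB.
transitivity (\int[P]_w ((v i k w * v i k w) * ind i k (A `&` B) w)).
  by apply: eq_integral => w _; rewrite muleC /ind indicI EFinM.
under [RHS]eq_integral do rewrite muleC.
apply: (cond_indep_integral1 GO (L := fun _ => P0) _ theta_indep) => //.
- exact: measurableI.
- by apply: emeasurable_funM; exact: v_G.
- by move=> w; exact: mule_ge0.
Qed.

Let integral_01_fin_num (f : Omega -> \bar R) : measurable_fun setT f ->
  (forall w, 0 <= f w <= 1) -> \int[P]_w f w \is a fin_num.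
Proof.
move=> mf f01; rewrite ge0_fin_numE; last first.
  by apply: integral_ge0 => w _; have /andP[] := f01 w.
apply: (@le_lt_trans _ _ (\int[P]_w cst 1 w)); last first.
  by rewrite integral_probability_cst ltry.
by apply: ge0_le_integral => // w _; have /andP[] := f01 w.
Qed.

Let P0_01 w A : measurable A -> 0 <= P0 w A <= 1.
Proof. by move=> mA; rewrite P0_ge0 probability_le1. Qed.

(** A shared atom contributes [P0 w (A]&[B)] and two different atoms [P0 w A * P0 w B]. Both are
    [F]-measurable, hence decoupled from the weights, and their means are the [z1] and [z2] of the
    mixture. *)
Lemma stick_atom_moment_same i A B : measurable A -> measurable B ->
  \int[P]_w (val i w A * val i w B) =
  ((1 + a)^-1 * fine (\int[P]_w P0 w (A `&` B)) +
   (1 - (1 + a)^-1) * fine (\int[P]_w (P0 w A * P0 w B)))%:E.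
Proof.
move=> mA mB; have mAB := measurableI _ _ mA mB.
rewrite integral_val//; apply: integral_mixture => //.
- by move=> k; exact: mind.
- by move=> k; exact: mind.
- exact: (ae_sum_abs_stick (psiF i) (XE i)).
- exact: (nneseries_abs_stick2 FO a0 (psiF i)).
- by apply: fine_ge0; exact: integral_ge0.
- by apply: fine_ge0; apply: integral_ge0 => w _; exact: mule_ge0.
move=> k l; have [<-|kl] := eqVneq k l.
  rewrite integral_ind_same// (integral_abs_stickM FO (psiF i))//; last exact: P0_F.
  rewrite muleC fineK//; apply: integral_01_fin_num; first exact: mP0.
  by move=> w; exact: P0_01.
rewrite integral_ind_diff//; last by apply: contraNN kl => /eqP[->].
rewrite (integral_abs_stickM FO (psiF i))//.
- rewrite muleC fineK//; apply: integral_01_fin_num.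
    by apply: emeasurable_funM; exact: mP0.
  move=> w; rewrite mule_ge0//= -[leRHS]mule1 lee_pmul//.
  + by have /andP[] := P0_01 w mA.
  + by have /andP[] := P0_01 w mB.
- by apply: emeasurable_funM; exact: P0_F.
- by move=> w; exact: mule_ge0.
Qed.

(** Two processes never share an atom label, so there is no diagonal. Once the atoms are integrated
    out, each series factors as [P0] times a sum of weights equal to 1. *)
Lemma stick_atom_moment_diff i j A B : i != j -> measurable A -> measurable B ->
  \int[P]_w (val i w A * val j w B) = \int[P]_w (P0 w A * P0 w B).
Proof.
move=> ij mA mB; rewrite integral_val//.
have mvf i' k (f : Omega -> \bar R) : measurable_fun setT f ->
    measurable_fun setT (fun w => v i' k w * f w).
  by move=> mf; exact: emeasurable_funM.
rewrite ge0_integral_nneseriesM; last 4 first.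
- by move=> k; apply: mvf; exact: mind.
- by move=> k; apply: mvf; exact: mind.
- by move=> k w; exact: mule_ge0.
- by move=> k w; exact: mule_ge0.
transitivity (\sum_(0 <= k <oo) \sum_(0 <= l <oo)
    \int[P]_w ((v i k w * P0 w A) * (v j l w * P0 w B))).
  apply: eq_eseriesr => k _; apply: eq_eseriesr => l _.
  under eq_integral do rewrite muleACA muleC.
  rewrite integral_ind_diff//; last by apply: contraNN ij => /eqP[->].
  by apply: eq_integral => w _; rewrite [RHS]muleACA [RHS]muleC.
rewrite -ge0_integral_nneseriesM; last 4 first.
- by move=> k; apply: mvf; exact: mP0.
- by move=> k; apply: mvf; exact: mP0.
- by move=> k w; exact: mule_ge0.
- by move=> k w; exact: mule_ge0.
apply: ge0_ae_eq_integral => //.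
- apply: emeasurable_funM; apply: measurable_fun_nneseries.
  + by move=> k; apply: mvf; exact: mP0.
  + by move=> k w; exact: mule_ge0.
  + by move=> k; apply: mvf; exact: mP0.
  + by move=> k w; exact: mule_ge0.
- by apply: emeasurable_funM; exact: mP0.
- move=> w _; apply: mule_ge0; apply: nneseries_ge0 => k _ _; exact: mule_ge0.
- by move=> w _; exact: mule_ge0.
apply: filterS2 (ae_sum_abs_stick (psiF i) (XE i))
  (ae_sum_abs_stick (psiF j) (XE j)) => w iE jE _.
by rewrite !ge0_nneseriesZr// iE jE !mul1e.
Qed.

End sticks_and_atoms.

Lemma iid_DP_moment_same i A B : measurable A -> measurable B ->
  \int[P]_w (val i w A * val i w B) =
  ((1 + a)^-1 * fine (\int[P]_w P0 w (A `&` B)) +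
   (1 - (1 + a)^-1) * fine (\int[P]_w (P0 w A * P0 w B)))%:E.
Proof.
have [psi [theta [psi_indep theta_indep XE]]] := X_DP.
exact: (stick_atom_moment_same psi_indep theta_indep XE).
Qed.

Lemma iid_DP_moment_diff i j A B : i != j -> measurable A -> measurable B ->
  \int[P]_w (val i w A * val j w B) = \int[P]_w (P0 w A * P0 w B).
Proof.
have [psi [theta [psi_indep theta_indep XE]]] := X_DP.
exact: (stick_atom_moment_diff psi_indep theta_indep XE).
Qed.

End iid_DP_moments.

(** * Second moments of the NDP-HDP prior *)

Section random_selection.
Local Open Scope ereal_scope.
Context (R : realType) d (Omega : measurableType d) (P : probability Omega R).
Context d' (T : measurableType d') (I : eqType).
Variables (K : set (set Omega)) (a : R).
Variables (psi : nat -> {RV P >-> R}) (theta : nat -> {RV P >-> T}).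
Variables (Q : {RV P >-> pprobability T R}) (X : I -> {RV P >-> T}).
Hypothesis a0 : (0 < a)%R.
Hypothesis KO : <<s K >> `<=` measurable.
Hypothesis theta_K : forall k A, measurable A -> <<s K >> (theta k @^-1` A).
Hypothesis psi_indep : cond_indep <<s K >> (fun _ _ => beta_law 1 a) psi.
Hypothesis QE : stick_breaking P psi theta Q.
Hypothesis X_indep : cond_indep (sigma_of (fun _ : unit => Q))
  (fun _ w => (Q w : probability T R)) X.

Let v k w : \bar R := (abs_stick psi k w)%:E.

Let v_ge0 k w : 0 <= v k w. Proof. exact: abs_stick_ge0. Qed.

Let mv k : measurable_fun setT (v k). Proof. exact: measurable_abs_stick. Qed.

(** Almost surely the integral of [h] against [Q w], written over the atoms. *)
Let average (h : T -> \bar R) (w : Omega) : \bar R :=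
  \sum_(0 <= k <oo) v k w * h (theta k w).

Let mtheta (h : T -> \bar R) k : measurable_fun setT h ->
  measurable_fun setT (fun w => h (theta k w)).
Proof. by move=> mh; apply: measurableT_comp => //; exact: measurable_funP. Qed.

Let mX (h : T -> \bar R) i : measurable_fun setT h ->
  measurable_fun setT (fun w => h (X i w)).
Proof. by move=> mh; apply: measurableT_comp => //; exact: measurable_funP. Qed.

Let theta_meas (h : T -> \bar R) k : measurable_fun setT h ->
  measurable_fun setT ((fun w => h (theta k w)) : g_sigma_algebraType K -> \bar R).
Proof.
move=> mh; apply: (measurableT_comp mh) => _ A mA; rewrite setTI.
exact: theta_K.
Qed.

Let average_ge0 h w : (forall x, 0 <= h x) -> 0 <= average h w.
Proof. by move=> h0; apply: nneseries_ge0 => k _ _; exact: mule_ge0. Qed.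

Let maverage h : measurable_fun setT h -> (forall x, 0 <= h x) ->
  measurable_fun setT (average h).
Proof.
move=> mh h0; apply: measurable_fun_nneseries => k.
  by apply: emeasurable_funM => //; exact: mtheta.
by move=> w; exact: mule_ge0.
Qed.

Let ind (A : set T) (x : T) : \bar R := (\1_A x)%:E.

Let ind_ge0 A x : 0 <= ind A x. Proof. by rewrite lee_fin. Qed.

Let mind A : measurable A -> measurable_fun setT (ind A).
Proof. by move=> mA; apply/measurable_EFinP; exact: measurable_indic. Qed.

Let ae_Q : {ae P, forall w, forall A, measurable A ->
  (Q w : probability T R) A = average (ind A) w}.
Proof. exact: (stick_breaking_abs psi_indep QE). Qed.

Let integral_average (h : T -> \bar R) (S : Omega -> \bar R) :
  measurable_fun setT h -> (forall x, 0 <= h x) ->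
  measurable_fun setT S -> (forall w, 0 <= S w) ->
  \int[P]_w (average h w * S w) =
  \sum_(0 <= k <oo) \int[P]_w (h (theta k w) * (v k w * S w)).
Proof.
move=> mh h0 mS S0; rewrite ge0_integral_nneseriesZ//.
- apply: eq_eseriesr => k _; apply: eq_integral => w _.
  by rewrite -muleA muleCA.
- by move=> k; apply: emeasurable_funM => //; exact: mtheta.
- by move=> k w; exact: mule_ge0.
Qed.

(* An identity between integrals of indicators of X i extends to functions, as
   both sides are integrals for a measure on T. *)
Let extend_average i (W S : Omega -> \bar R) :
  measurable_fun setT W -> (forall w, 0 <= W w) ->
  measurable_fun setT S -> (forall w, 0 <= S w) ->
  (forall A, measurable A ->
    \int[P]_w (ind A (X i w) * W w) = \int[P]_w (average (ind A) w * S w)) ->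
  forall h, measurable_fun setT h -> (forall x, 0 <= h x) ->
    \int[P]_w (h (X i w) * W w) = \int[P]_w (average h w * S w).
Proof.
move=> mW W0 mS S0 e h mh h0; rewrite integral_average//.
apply: eq_integral_weighted_law_series => //.
- by move=> k; exact: emeasurable_funM.
- by move=> k w; exact: mule_ge0.
move=> A mA.
transitivity (\int[P]_w (ind A (X i w) * W w)).
  rewrite integral_mkcond epatch_indic; apply: eq_integral => w _.
  by rewrite /= muleC.
rewrite e// integral_average//; last exact: mind.
apply: eq_eseriesr => k _; rewrite [RHS]integral_mkcond epatch_indic.
by apply: eq_integral => w _; rewrite /= muleC.
Qed.

Let QK := \bigcup_(i : unit) preimage_set_system setT Q measurable.

Let QO : <<s QK >> `<=` measurable.
Proof.
exact: (@sigma_of_sub_measurable _ _ _ _ unit (fun _ : unit => Q)).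
Qed.

Let mQ A : measurable A -> measurable_fun setT (fun w => (Q w : probability T R) A).
Proof. by move=> mA; exact: measurable_pprobability. Qed.

(** Two independent selections pick the same atom with probability 1 / (1 + a). The functions are
    general because the atoms will themselves be probability measures, evaluated at sets. *)
Lemma selection_pair i j (f g : T -> \bar R) (z1 z2 : R) : i != j ->
  measurable_fun setT f -> (forall x, 0 <= f x) ->
  measurable_fun setT g -> (forall x, 0 <= g x) ->
  (0 <= z1)%R -> (0 <= z2)%R ->
  (forall k l, \int[P]_w (f (theta k w) * g (theta l w)) =
    (if k == l then z1 else z2)%:E) ->
  \int[P]_w (f (X i w) * g (X j w)) =
  ((1 + a)^-1 * z1 + (1 - (1 + a)^-1) * z2)%:E.
Proof.
move=> ij mf f0 mg g0 z10 z20 fg.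
transitivity (\int[P]_w (average f w * average g w)).
  (* The extension is used twice: [f] is reduced to an indicator of [X i] while [g] stays, then [g]
     to an indicator of [X j], where independence given [Q] applies. *)
  apply: extend_average => //; [exact: mX|exact: maverage|by move=> w; exact: average_ge0|].
  move=> A mA; under eq_integral do rewrite muleC.
  under [RHS]eq_integral do rewrite muleC.
  apply: extend_average => //.
  - by apply: mX; exact: mind.
  - by apply: maverage => //; exact: mind.
  - by move=> w; exact: average_ge0.
  move=> B mB; under eq_integral do rewrite muleC.
  under [RHS]eq_integral do rewrite muleC.
  transitivity (\int[P]_w (cst 1 w * (ind A (X i w) * ind B (X j w)))).
    by apply: eq_integral => w _; rewrite /= mul1e.
  rewrite (cond_indep_integral2 QO (L := fun _ w => Q w) _ X_indep)//.
  apply: ge0_ae_eq_integral => //.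
  - by apply: emeasurable_funM => //; apply: emeasurable_funM; exact: mQ.
  - by apply: emeasurable_funM; apply: maverage => //; exact: mind.
  - by move=> w _; rewrite mul1e mule_ge0.
  - by move=> w _; apply: mule_ge0; exact: average_ge0.
  by apply: filterS ae_Q => w wE _; rewrite mul1e !wE.
apply: (integral_mixture (v := v) (f := fun k w => f (theta k w))
  (g := fun k w => g (theta k w))) => //.
- by move=> k; exact: mtheta.
- by move=> k; exact: mtheta.
- exact: (ae_sum_abs_stick psi_indep QE).
- exact: (nneseries_abs_stick2 KO a0 psi_indep).
move=> k l; rewrite (integral_abs_stickM KO psi_indep)//.
- by rewrite fg muleC.
- by apply: emeasurable_funM; exact: theta_meas.
- by move=> w; exact: mule_ge0.
Qed.

Lemma selection_single i (f : T -> \bar R) (z : R) :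
  measurable_fun setT f -> (forall x, 0 <= f x) -> (0 <= z)%R ->
  (forall k, \int[P]_w f (theta k w) = z%:E) ->
  \int[P]_w f (X i w) = z%:E.
Proof.
move=> mf f0 z0 fz.
have v1 := ae_sum_abs_stick psi_indep QE.
transitivity (\int[P]_w (f (X i w) * cst 1 w)).
  by apply: eq_integral => w _; rewrite /= mule1.
transitivity (\int[P]_w (average f w * cst 1 w)).
  apply: extend_average => // A mA.
  transitivity (\int[P]_w (cst 1 w * ind A (X i w))).
    by apply: eq_integral => w _; rewrite muleC.
  rewrite (cond_indep_integral1 QO (L := fun _ w => Q w) _ X_indep)//.
  apply: ge0_ae_eq_integral => //.
  - by apply: emeasurable_funM => //; exact: mQ.
  - by apply: emeasurable_funM => //; apply: maverage => //; exact: mind.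
  - by move=> w _; apply: mule_ge0 => //; exact: average_ge0.
  - by move=> w _; apply: mule_ge0 => //; exact: average_ge0.
  by apply: filterS ae_Q => w wE _; rewrite muleC wE.
(* A factor almost surely equal to 1 turns the single average into a product, so that the mixture
   formula applies with [z1] and [z2] both equal to [z]. *)
transitivity (\int[P]_w (average f w * average (cst 1) w)).
  apply: ge0_ae_eq_integral => //.
  - by apply: emeasurable_funM => //; apply: maverage.
  - by apply: emeasurable_funM; apply: maverage.
  - by move=> w _; apply: mule_ge0 => //; exact: average_ge0.
  - by move=> w _; apply: mule_ge0; exact: average_ge0.
  move: v1; apply: filterS => w w1 _; congr (_ * _).
  apply: (etrans (esym w1)).
  by apply: eq_eseriesr => k _; rewrite mule1.
transitivity (((1 + a)^-1 * z + (1 - (1 + a)^-1) * z)%:E); last first.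
  by congr EFin; ring.
apply: (integral_mixture (v := v) (f := fun k w => f (theta k w))
  (g := fun k w => 1)) => //.
- by move=> k; exact: mtheta.
- exact: (nneseries_abs_stick2 KO a0 psi_indep).
move=> k l; under eq_integral do rewrite mule1.
rewrite (integral_abs_stickM KO psi_indep)//; last exact: theta_meas.
by rewrite fz if_same muleC.
Qed.

End random_selection.

Lemma trivial_sigma_algebra (T : Type) : sigma_algebra setT [set set0; [set: T]].
Proof.
split; first by left.
  by move=> _ [->|->]; [right; rewrite setD0|left; rewrite setDT].
move=> A HA; have [[n An]|noT] := pselect (exists n, A n = setT).
  by right; apply/seteqP; split=> // x _; exists n => //; rewrite An.
left; rewrite bigcup0// => n _; have [//|An] := HA n.
by exfalso; apply: noT; exists n.
Qed.

Section NDP_HDP_moments.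
Local Open Scope ereal_scope.
Context (R : realType) d (Omega : measurableType d) (P : probability Omega R).
Context d' (T : measurableType d') (H : probability T R).
Variables (alpha gamma nu : R).
Hypotheses (alpha0 : (0 < alpha)%R) (gamma0 : (0 < gamma)%R) (nu0 : (0 < nu)%R).

(** Equal to 1/(1 + gamma) + gamma/(1 + gamma) * 1/(1 + alpha): two draws share an atom of their
    group, or failing that an atom of [G0]. *)
Definition same_group_coef : R :=
  ((alpha + gamma + 1) / ((alpha + 1) * (gamma + 1)))%R.

(** Equal to 1/(1 + nu) times [same_group_coef] plus nu/(1 + nu) * 1/(1 + alpha): two groups select
    the same atom of [Q], or two atoms that have only [G0] in common. *)
Definition diff_group_coef : R :=
  ((nu * gamma + alpha + gamma + nu + 1) /
   ((nu + 1) * (alpha + 1) * (gamma + 1)))%R.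

(** The law on rectangles of a pair with marginals [H] whose entries are equal with probability [c]
    and independent otherwise. *)
Definition mixed_moment (c : R) (A B : set T) : R :=
  (c * fine (H (A `&` B)) + (1 - c) * (fine (H A) * fine (H B)))%R.

Let HE A : measurable A -> H A = (fine (H A))%:E.
Proof. by move=> mA; rewrite fineK// fin_num_measure. Qed.

Let H0 A : (0 <= fine (H A))%R. Proof. exact: fine_ge0. Qed.

Section hierarchy.
Variables (G0 : {RV P >-> pprobability T R}).
Variables (Gstar : nat -> {RV P >-> pprobability T R}).
Let F0 := sigma_of (fun _ : unit => G0).
Hypothesis G0_DP : iid_DP [set set0; setT] alpha (fun _ => H) (fun _ : unit => G0).
Hypothesis Gstar_DP : iid_DP F0 gamma G0 Gstar.

Local Notation val X w A := ((X w : probability T R) A).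

Lemma G0_moment A B : measurable A -> measurable B ->
  \int[P]_w (val G0 w A * val G0 w B) =
  (mixed_moment (1 + alpha)^-1 A B)%:E.
Proof.
move=> mA mB.
rewrite (iid_DP_moment_same (trivial_sigma_algebra _) _ _ alpha0 G0_DP tt mA mB).
- rewrite !integral_probability_cst /mixed_moment fineM//.
  + exact: fin_num_measure.
  + exact: fin_num_measure.
- by move=> _ [->|->].
- by move=> C mC; exact: measurable_cst.
Qed.

Let F0_sigma : sigma_algebra setT F0.
Proof. exact: smallest_sigma_algebra. Qed.

Let F0_sub : F0 `<=` measurable.
Proof. by apply: sigma_of_sub_measurable => _; exact: measurable_funP. Qed.

Let G0_F0 A : measurable A ->
  measurable_fun setT (fun w : g_sigma_algebraType F0 => val G0 w A).
Proof.
move=> mA; apply: (@measurable_pprobability _ (g_sigma_algebraType F0)) => //.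
move=> _ B mB; rewrite setTI; apply: sub_sigma_algebra.
exact: (@sigma_of_preimage _ _ _ _ _ (fun _ : unit => G0) tt).
Qed.

Lemma Gstar_moment k l A B : measurable A -> measurable B ->
  \int[P]_w (val (Gstar k) w A * val (Gstar l) w B) =
  (if k == l then mixed_moment same_group_coef A B
   else mixed_moment (1 + alpha)^-1 A B)%:E.
Proof.
move=> mA mB; have mAB := measurableI _ _ mA mB.
have [<-|kl] := eqVneq k l; last first.
  rewrite (iid_DP_moment_diff F0_sigma F0_sub G0_F0 Gstar_DP kl mA mB).
  exact: G0_moment.
rewrite (iid_DP_moment_same F0_sigma F0_sub G0_F0 gamma0 Gstar_DP k mA mB).
(* A first moment is a second moment against the whole space, where the coefficients c and 1 - c add
   up to 1. *)
have -> : \int[P]_w val G0 w (A `&` B) = (fine (H (A `&` B)))%:E.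
  transitivity (\int[P]_w (val G0 w (A `&` B) * val G0 w setT)).
    by apply: eq_integral => w _; rewrite probability_setT mule1.
  rewrite G0_moment// /mixed_moment setIT probability_setT mulr1.
  by congr EFin; ring.
rewrite G0_moment// /mixed_moment /same_group_coef; congr EFin => /=.
by field; rewrite !gt_eqF ?addr_gt0.
Qed.

End hierarchy.

Variables (m : nat) (G : 'I_m -> {RV P >-> pprobability T R}).
Hypothesis G_NDP : NDP_HDP alpha gamma nu H G.

Local Notation val j w A := ((G j w : probability T R) A).

Let mval A : measurable A ->
  measurable_fun setT (fun p : pprobability T R => (p : probability T R) A).
Proof. by move=> mA; apply: measurable_pprobability. Qed.

Let mixed_moment_ge0 c A B : (0 <= c <= 1)%R -> (0 <= mixed_moment c A B)%R.
Proof.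
by move=> /andP[c0 c1]; rewrite addr_ge0 ?mulr_ge0 ?subr_ge0.
Qed.

Lemma same_group_coef_01 : (0 <= same_group_coef <= 1)%R.
Proof.
rewrite /same_group_coef; apply/andP; split.
  by rewrite divr_ge0 ?mulr_ge0 ?addr_ge0// ltW.
rewrite ler_pdivrMr ?mulr_gt0 ?addr_gt0// mul1r.
(* The denominator exceeds the numerator by [alpha * gamma]. *)
have := mulr_gt0 alpha0 gamma0; nra.
Qed.

Lemma diff_group_coef_01 : (0 <= diff_group_coef <= 1)%R.
Proof.
rewrite /diff_group_coef; apply/andP; split.
  by rewrite divr_ge0 ?mulr_ge0 ?addr_ge0 ?mulr_ge0// ltW.
rewrite ler_pdivrMr ?mulr_gt0 ?addr_gt0// mul1r.
(* The excess of the denominator is now alpha gamma + nu alpha + nu alpha gamma. *)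
have ag := mulr_gt0 alpha0 gamma0; have na := mulr_gt0 nu0 alpha0.
have := mulr_gt0 nu0 ag; nra.
Qed.

Let alpha_01 : (0 <= (1 + alpha)^-1 <= 1)%R.
Proof.
apply/andP; split; first by rewrite invr_ge0 addr_ge0// ltW.
by rewrite invf_le1 ?addr_gt0// lerDl ltW.
Qed.

Let hierarchy_sub (G0 : {RV P >-> pprobability T R})
    (Gstar : nat -> {RV P >-> pprobability T R}) :
  <<s sigma_of (fun _ : unit => G0) `|` sigma_of Gstar >> `<=` measurable.
Proof.
apply: smallest_sub; first exact: sigma_algebra_measurable.
move=> A [|]; apply: sigma_of_sub_measurable => ?; exact: measurable_funP.
Qed.

Let hierarchy_preimage (G0 : {RV P >-> pprobability T R})
    (Gstar : nat -> {RV P >-> pprobability T R}) k B : measurable B ->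
  <<s sigma_of (fun _ : unit => G0) `|` sigma_of Gstar >> (Gstar k @^-1` B).
Proof.
by move=> mB; apply: sub_sigma_algebra; right; exact: sigma_of_preimage.
Qed.

(** The product is one function of a single draw from [Q], so its mean is that of any atom
    [Gstar k]; this is why [nu] is absent from the coefficient. *)
Lemma NDP_HDP_moment_same j A B : measurable A -> measurable B ->
  \int[P]_w (val j w A * val j w B) = (mixed_moment same_group_coef A B)%:E.
Proof.
move=> mA mB; have [G0 [Gstar [psi [Q [G0_DP Gstar_DP psi_indep QE GQ]]]]] := G_NDP.
apply: (selection_single nu0 (@hierarchy_sub G0 Gstar)
  (@hierarchy_preimage G0 Gstar) psi_indep QE GQ
  j (f := fun p => (p : probability T R) A * (p : probability T R) B)).
- by apply: emeasurable_funM; exact: mval.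
- by move=> p; exact: mule_ge0.
- exact: mixed_moment_ge0 same_group_coef_01.
- by move=> k; rewrite (Gstar_moment G0_DP Gstar_DP)// eqxx.
Qed.

Lemma NDP_HDP_moment_diff i j A B : i != j -> measurable A -> measurable B ->
  \int[P]_w (val i w A * val j w B) = (mixed_moment diff_group_coef A B)%:E.
Proof.
move=> ij mA mB.
have [G0 [Gstar [psi [Q [G0_DP Gstar_DP psi_indep QE GQ]]]]] := G_NDP.
rewrite (selection_pair nu0 (@hierarchy_sub G0 Gstar)
  (@hierarchy_preimage G0 Gstar) psi_indep QE GQ
  (f := fun p => (p : probability T R) A) (g := fun p => (p : probability T R) B)
  (z1 := mixed_moment same_group_coef A B)
  (z2 := mixed_moment (1 + alpha)^-1 A B) ij)//.
- rewrite /mixed_moment /same_group_coef /diff_group_coef; congr EFin => /=.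
  by field; rewrite !gt_eqF ?addr_gt0.
- exact: mval.
- exact: mval.
- exact: mixed_moment_ge0 same_group_coef_01.
- exact: mixed_moment_ge0.
- by move=> k l; rewrite (Gstar_moment G0_DP Gstar_DP).
Qed.

Lemma NDP_HDP_mean j A : measurable A -> \int[P]_w val j w A = H A.
Proof.
move=> mA.
transitivity (\int[P]_w (val j w A * val j w setT)).
  by apply: eq_integral => w _; rewrite probability_setT mule1.
rewrite NDP_HDP_moment_same// /mixed_moment setIT probability_setT mulr1 [RHS]HE//.
by congr EFin; ring.
Qed.

End NDP_HDP_moments.

(** * Covariance of a pair of draws *)

Section Lfun2.
Context d (T : measurableType d) (R : realType) (mu : {measure set T -> \bar R}).
Local Open Scope ereal_scope.

Lemma Lfun2_integral_sqr_lty (f : T -> R) : measurable_fun setT f ->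
  \int[mu]_x (f x ^+ 2)%:E < +oo -> f \in Lfun mu 2%:E.
Proof.
move=> mf foo; rewrite inE; apply/andP; split; first by rewrite inE.
rewrite inE/= /finite_norm unlock /Lnorm poweR_lty//.
rewrite (le_lt_trans _ foo)//; apply: ge0_le_integral => //.
- by move=> x _; exact: poweR_ge0.
- apply/measurable_EFinP.
  apply/(@measurableT_comp _ _ _ _ _ _ (fun x : R => x `^ 2)%R) => //.
  exact/measurableT_comp.
- by apply/measurable_EFinP; exact: measurable_funX.
- by move=> x _ /=; rewrite lee_fin powR_mulrn// real_normK ?num_real.
Qed.

Lemma Lfun_measurable (f : T -> R) p : f \in Lfun mu p -> measurable_fun setT f.
Proof. by rewrite inE => /andP[]; rewrite inE. Qed.

Lemma Lfun2_le_norm (f g : T -> R) : measurable_fun setT g ->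
  (forall x, `|g x| <= `|f x|)%R -> f \in Lfun mu 2%:E -> g \in Lfun mu 2%:E.
Proof.
move=> mg gf f2; apply: Lfun2_integral_sqr_lty => //.
have fi := integrable_lty measurableT (Lfun2_integrable_sqr f2).
apply: le_lt_trans fi; apply: ge0_le_integral => //.
- by move=> x _; rewrite lee_fin sqr_ge0.
- by apply/measurable_EFinP; exact: measurable_funX.
- by apply/measurable_EFinP; apply: measurable_funX; exact: Lfun_measurable f2.
move=> x _ /=; rewrite lee_fin -(real_normK (num_real (g x))).
by rewrite -(real_normK (num_real (f x))) lerXn2r ?nnegrE.
Qed.

Lemma Lfun2_funrpos (f : T -> R) : f \in Lfun mu 2%:E -> (f^\+)%R \in Lfun mu 2%:E.
Proof.
move=> f2; apply: (Lfun2_le_norm _ _ f2).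
  by apply: measurable_funrpos; exact: Lfun_measurable f2.
move=> x; rewrite ger0_norm ?funrpos_ge0// /funrpos ge_max normr_ge0 andbT.
exact: ler_norm.
Qed.

Lemma Lfun2_funrneg (f : T -> R) : f \in Lfun mu 2%:E -> (f^\-)%R \in Lfun mu 2%:E.
Proof.
move=> f2; apply: (Lfun2_le_norm _ _ f2).
  by apply: measurable_funrneg; exact: Lfun_measurable f2.
move=> x; rewrite ger0_norm ?funrneg_ge0// /funrneg ge_max normr_ge0 andbT.
by rewrite -normrN ler_norm.
Qed.

End Lfun2.

Section exchangeable_pair.
Local Open Scope ereal_scope.
Context (R : realType) d (Omega : measurableType d) (P : probability Omega R).
Context d' (T : measurableType d') (H : probability T R).
Variables (X Y : {RV P >-> T}) (c : R).
Hypothesis c01 : (0 <= c <= 1)%R.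
Hypothesis XY : forall A B, measurable A -> measurable B ->
  \int[P]_w ((\1_A (X w))%:E * (\1_B (Y w))%:E) = (mixed_moment H c A B)%:E.

Let c0 : (0 <= c)%R. Proof. by have /andP[] := c01. Qed.

Let c1 : (0 <= 1 - c)%R. Proof. by rewrite subr_ge0; have /andP[] := c01. Qed.

Let mXf (f : T -> \bar R) : measurable_fun setT f ->
  measurable_fun setT (fun w => f (X w)).
Proof. by move=> mf; apply: measurableT_comp => //; exact: measurable_funP. Qed.

Let mYf (f : T -> \bar R) : measurable_fun setT f ->
  measurable_fun setT (fun w => f (Y w)).
Proof. by move=> mf; apply: measurableT_comp => //; exact: measurable_funP. Qed.

Let ind (A : set T) (x : T) : \bar R := (\1_A x)%:E.

Let ind_ge0 A x : 0 <= ind A x. Proof. by rewrite lee_fin. Qed.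

Let mind A : measurable A -> measurable_fun setT (ind A).
Proof. by move=> mA; apply/measurable_EFinP; exact: measurable_indic. Qed.

(** The conditional expectation of [f (Y)] given that [X] equals [x]. It rewrites the two-point law
    as a density against [H]. *)
Let mix (f : T -> \bar R) (x : T) : \bar R :=
  c%:E * f x + (1 - c)%:E * \int[H]_y f y.

Let mix_ge0 f x : (forall y, 0 <= f y) -> 0 <= mix f x.
Proof. by move=> f0; rewrite adde_ge0 ?mule_ge0 ?lee_fin ?integral_ge0. Qed.

Let mmix f : measurable_fun setT f -> measurable_fun setT (mix f).
Proof.
by move=> mf; apply: emeasurable_funD => //; exact: measurable_funeM.
Qed.

Let integral_mix (f g : T -> \bar R) :
  measurable_fun setT f -> (forall x, 0 <= f x) ->
  measurable_fun setT g -> (forall x, 0 <= g x) ->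
  \int[H]_x (g x * mix f x) =
  c%:E * (\int[H]_x (f x * g x)) + (1 - c)%:E * ((\int[H]_x f x) * \int[H]_x g x).
Proof.
move=> mf f0 mg g0.
have If : 0 <= \int[H]_x f x by exact: integral_ge0.
have k0 : 0 <= (1 - c)%:E * \int[H]_x f x by rewrite mule_ge0// lee_fin.
transitivity (\int[H]_x (c%:E * (f x * g x) + ((1 - c)%:E * \int[H]_x f x) * g x)).
  apply: eq_integral => x _; rewrite /mix ge0_muleDr//; last first.
    by rewrite mule_ge0// lee_fin.
  by rewrite [in LHS]muleC -muleA [X in _ + X]muleC.
rewrite ge0_integralD//.
- rewrite ge0_integralZl_EFin//; last 2 first.
  + by move=> x _; exact: mule_ge0.
  + exact: emeasurable_funM.
  by rewrite ge0_integralZl// muleA.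
- by move=> x _; rewrite !mule_ge0// lee_fin.
- by apply: measurable_funeM; exact: emeasurable_funM.
- by move=> x _; rewrite mule_ge0.
- exact: measurable_funeM.
Qed.

Lemma ge0_integral_pair (f g : T -> \bar R) :
  measurable_fun setT f -> (forall x, 0 <= f x) ->
  measurable_fun setT g -> (forall x, 0 <= g x) ->
  \int[P]_w (f (X w) * g (Y w)) =
  c%:E * (\int[H]_x (f x * g x)) + (1 - c)%:E * ((\int[H]_x f x) * \int[H]_x g x).
Proof.
have int_ind A : measurable A -> \int[H]_x ind A x = H A.
  by move=> mA; rewrite integral_indic// setIT.
have base A B : measurable A -> measurable B ->
    \int[P]_w (ind A (X w) * ind B (Y w)) = \int[H]_x (ind A x * mix (ind B) x).
  move=> mA mB; rewrite XY// integral_mix//; [|exact: mind|exact: mind].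
  rewrite !int_ind// (_ : (fun x => _) = ind (B `&` A)); last first.
    by apply/funext => x; rewrite /ind indicI EFinM.
  rewrite int_ind//; last exact: measurableI.
  rewrite -[H A]fineK ?fin_num_measure// -[H B]fineK ?fin_num_measure//.
  rewrite -[H (B `&` A)]fineK ?fin_num_measure//; last exact: measurableI.
  by rewrite -!EFinM -EFinD/= /mixed_moment setIC [X in (_ + _ * X)%R]mulrC.
have int_pre (mu : {measure set Omega -> \bar R}) (Z : Omega -> T) A (W : Omega -> \bar R) :
    \int[mu]_(w in Z @^-1` A) W w = \int[mu]_w (ind A (Z w) * W w).
  rewrite integral_mkcond epatch_indic; apply: eq_integral => w _.
  by rewrite /= muleC.
have int_id A (W : T -> \bar R) :
    \int[H]_(x in id @^-1` A) W x = \int[H]_x (ind A x * W x).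
  rewrite integral_mkcond epatch_indic; apply: eq_integral => w _.
  by rewrite /= muleC.
(* The indicator of [X] becomes a function while [Y] keeps its indicator; the second variable
   follows by the same comparison, with the roles exchanged. *)
have half B : measurable B -> measurable_fun setT f -> (forall x, 0 <= f x) ->
    \int[P]_w (f (X w) * ind B (Y w)) = \int[H]_x (f x * mix (ind B) x).
  move=> mB mf f0.
  apply: (eq_integral_weighted_law (X1 := X) (X2 := id)) => //.
  - by apply: mYf; exact: mind.
  - by apply: mmix; exact: mind.
  - by move=> x; exact: mix_ge0.
  - by move=> A mA; rewrite int_pre int_id base.
move=> mf f0 mg g0; rewrite -integral_mix//.
under eq_integral do rewrite muleC.
apply: (eq_integral_weighted_law (X1 := Y) (X2 := id)) => //.
- exact: mXf.
- exact: mmix.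
- by move=> x; exact: mix_ge0.
move=> B mB; rewrite int_pre int_id.
under eq_integral do rewrite muleC.
rewrite half// (integral_mix (mind mB) _ mf f0)//.
rewrite (integral_mix mf f0 (mind mB) _)//.
congr (_ * _ + _ * _); last by rewrite muleC.
by apply: eq_integral => x _; rewrite muleC.
Qed.

End exchangeable_pair.

Section pair_covariance.
Local Open Scope ereal_scope.
Context (R : realType) d (Omega : measurableType d) (P : probability Omega R).
Context d' (T : measurableType d') (H : probability T R).

Definition pair_law (c : R) (X Y : {RV P >-> T}) :=
  forall A B, measurable A -> measurable B ->
  \int[P]_w ((\1_A (X w))%:E * (\1_B (Y w))%:E) = (mixed_moment H c A B)%:E.

Lemma pair_law_marginal c (X Y : {RV P >-> T}) (f : T -> \bar R) :
  (0 <= c <= 1)%R -> pair_law c X Y ->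
  measurable_fun setT f -> (forall x, 0 <= f x) ->
  \int[P]_w f (X w) = \int[H]_x f x.
Proof.
move=> c01 XY mf f0; have /andP[c0 c1] := c01.
transitivity (\int[P]_w (f (X w) * cst 1 (Y w))).
  by apply: eq_integral => w _; rewrite /= mule1.
rewrite (ge0_integral_pair c01 XY (g := cst 1))// integral_probability_cst mule1.
under eq_integral do rewrite mule1.
rewrite -ge0_muleDl ?lee_fin ?subr_ge0// -EFinD.
by rewrite (_ : (c + (1 - c) = 1)%R) ?mul1e//; ring.
Qed.

Lemma pair_lawC c (X Y : {RV P >-> T}) : pair_law c X Y -> pair_law c Y X.
Proof.
move=> XY A B mA mB; under eq_integral do rewrite muleC.
by rewrite XY// /mixed_moment setIC [X in (_ + _ * X)%R]mulrC.
Qed.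

(** A draw paired with itself is the case [c = 1], so variances become instances of the covariance
    formula. *)
Lemma pair_law_diag c (X Y : {RV P >-> T}) :
  (0 <= c <= 1)%R -> pair_law c X Y -> pair_law 1 X X.
Proof.
move=> c01 XY A B mA mB; have mAB := measurableI _ _ mA mB.
transitivity (\int[P]_w (\1_(A `&` B) (X w))%:E).
  by apply: eq_integral => w _; rewrite indicI EFinM.
rewrite (pair_law_marginal c01 XY (f := fun x => (\1_(A `&` B) x)%:E))//.
  rewrite integral_indic// setIT /mixed_moment subrr mul0r addr0 mul1r.
  by rewrite fineK// fin_num_measure.
by apply/measurable_EFinP; exact: measurable_indic.
Qed.

Lemma pair_law_Lfun2 c (X Y : {RV P >-> T}) (f : T -> R) :
  (0 <= c <= 1)%R -> pair_law c X Y ->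
  f \in Lfun H 2%:E -> (fun w => f (X w)) \in Lfun P 2%:E.
Proof.
move=> c01 XY f2; have mf := Lfun_measurable f2.
apply: Lfun2_integral_sqr_lty.
  by apply: measurableT_comp => //; exact: measurable_funP.
rewrite (pair_law_marginal c01 XY (f := fun x => (f x ^+ 2)%:E)).
- exact: (integrable_lty measurableT (Lfun2_integrable_sqr f2)).
- by apply/measurable_EFinP; exact: measurable_funX.
- by move=> x; rewrite lee_fin sqr_ge0.
Qed.

Let Hfin : H setT \is a fin_num. Proof. exact: fin_num_measure. Qed.
Let Pfin : P setT \is a fin_num. Proof. exact: fin_num_measure. Qed.

Lemma ge0_covariance_pair c (X Y : {RV P >-> T}) (f g : T -> R) :
  (0 <= c <= 1)%R -> pair_law c X Y ->
  (forall x, 0 <= f x)%R -> (forall x, 0 <= g x)%R ->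
  f \in Lfun H 2%:E -> g \in Lfun H 2%:E ->
  covariance P (fun w => f (X w)) (fun w => g (Y w)) =
  c%:E * covariance H f g.
Proof.
move=> c01 XY f0 g0 f2 g2.
have fX2 := pair_law_Lfun2 c01 XY f2.
have gY2 := pair_law_Lfun2 c01 (pair_lawC XY) g2.
have fg1 := Lfun2_mul_Lfun1 f2 g2.
have f1 := Lfun_subset12 Hfin f2; have g1 := Lfun_subset12 Hfin g2.
have mf : measurable_fun setT (EFin \o f).
  by apply/measurable_EFinP; exact: Lfun_measurable f2.
have mg : measurable_fun setT (EFin \o g).
  by apply/measurable_EFinP; exact: Lfun_measurable g2.
rewrite covarianceE; [|exact: Lfun_subset12|exact: Lfun_subset12|exact: Lfun2_mul_Lfun1].
rewrite [in RHS]covarianceE//.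
move: (expectation_fin_num fg1) (expectation_fin_num f1) (expectation_fin_num g1).
have -> : 'E_P[fun w => f (X w)] = 'E_H[f].
  by rewrite unlock (pair_law_marginal c01 XY (f := EFin \o f)).
have -> : 'E_P[fun w => g (Y w)] = 'E_H[g].
  by rewrite unlock (pair_law_marginal c01 (pair_lawC XY) (f := EFin \o g)).
have -> : 'E_P[(fun w => f (X w)) * (fun w => g (Y w))] =
    c%:E * 'E_H[f * g] + (1 - c)%:E * ('E_H[f] * 'E_H[g]).
  rewrite unlock; under eq_integral do rewrite EFinM.
  rewrite (ge0_integral_pair c01 XY (f := EFin \o f) (g := EFin \o g))//.
case: ('E_H[f * g]) => // x _; case: ('E_H[f]) => // y _; case: ('E_H[g]) => // z _.
by rewrite -!(EFinM, EFinN, EFinD); congr EFin; ring.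
Qed.

(** Positive and negative parts stay square integrable, so bilinearity reduces the claim to four
    covariances of nonnegative functions. *)
Lemma covariance_pair c (X Y : {RV P >-> T}) (f g : T -> R) :
  (0 <= c <= 1)%R -> pair_law c X Y ->
  f \in Lfun H 2%:E -> g \in Lfun H 2%:E ->
  covariance P (fun w => f (X w)) (fun w => g (Y w)) =
  c%:E * covariance H f g.
Proof.
move=> c01 XY f2 g2.
have fp2 := Lfun2_funrpos f2; have fn2 := Lfun2_funrneg f2.
have gp2 := Lfun2_funrpos g2; have gn2 := Lfun2_funrneg g2.
have LX h := pair_law_Lfun2 (f := h) c01 XY.
have LY h := pair_law_Lfun2 (f := h) c01 (pair_lawC XY).
have cfin h k : h \in Lfun H 2%:E -> k \in Lfun H 2%:E ->
    covariance H h k \is a fin_num.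
  move=> h2 k2; apply: covariance_fin_num; [exact: Lfun_subset12|exact: Lfun_subset12|].
  exact: Lfun2_mul_Lfun1.
have fE x : f x = (f^\+ x - f^\- x)%R by rewrite -[in LHS](funrposBneg f).
have gE x : g x = (g^\+ x - g^\- x)%R by rewrite -[in LHS](funrposBneg g).
have -> : (fun w => f (X w)) = ((fun w => f^\+ (X w)) \- (fun w => f^\- (X w)))%R.
  by apply/funext => w; rewrite fE.
have -> : (fun w => g (Y w)) = ((fun w => g^\+ (Y w)) \- (fun w => g^\- (Y w)))%R.
  by apply/funext => w; rewrite gE.
rewrite covarianceBl; [|exact: LX|exact: LX|by rewrite rpredB ?lee1n// => *; exact: LY].
rewrite !covarianceBr; [|exact: LX|exact: LY|exact: LY|exact: LX|exact: LY|exact: LY].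
rewrite !(ge0_covariance_pair c01 XY)//; do ?[by move=> x; exact: funrpos_ge0|
  by move=> x; exact: funrneg_ge0].
have -> : covariance H f g = covariance H (f^\+ \- f^\-)%R (g^\+ \- g^\-)%R.
  by congr covariance; apply/funext => x.
rewrite covarianceBl//; last by rewrite rpredB ?lee1n.
rewrite !covarianceBr//.
move: (cfin _ _ fp2 gp2) (cfin _ _ fp2 gn2) (cfin _ _ fn2 gp2) (cfin _ _ fn2 gn2).
do 4 (case: (covariance _ _ _) => // ? _).
by rewrite -!(EFinM, EFinN, EFinD); congr EFin; ring.
Qed.

Lemma correlation_pair c (X Y : {RV P >-> T}) (f g : T -> R) :
  (0 <= c <= 1)%R -> pair_law c X Y ->
  f \in Lfun H 2%:E -> g \in Lfun H 2%:E ->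
  correlation P (fun w => f (X w)) (fun w => g (Y w)) =
  (c * correlation H f g)%R.
Proof.
move=> c01 XY f2 g2.
have var Z h : pair_law 1 Z Z -> h \in Lfun H 2%:E ->
    variance P (fun w => h (Z w)) = variance H h.
  move=> ZZ h2; rewrite /variance (covariance_pair _ ZZ h2 h2) ?mul1e//.
  by rewrite ler01 lexx.
rewrite /correlation (covariance_pair c01 XY)// !var//.
- rewrite fineM//; first by rewrite mulrA.
  apply: covariance_fin_num; [exact: Lfun_subset12|exact: Lfun_subset12|].
  exact: Lfun2_mul_Lfun1.
- exact: (pair_law_diag c01 (pair_lawC XY)).
- exact: (pair_law_diag c01 XY).
Qed.

End pair_covariance.

(** The quotient is 1 unless the variance is 0, in which case the convention would make it 0. A zero
    variance would make [f] almost surely constant, and one level set would carry all the mass. *)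
Lemma correlation_id d (T : measurableType d) (R : realType)
    (H : probability T R) (f : T -> R) :
  f \in Lfun H 2%:E -> (forall r, H (f @^-1` [set r]) = 0%E) ->
  correlation H f f = 1.
Proof.
move=> f2 H0.
have mf := Lfun_measurable f2.
have vfin := variance_fin_num f2.
have v0 : 0 <= fine (variance H f) by apply: fine_ge0; exact: variance_ge0.
rewrite /correlation -expr2 sqr_sqrtr// divff//.
apply/eqP => v00.
have V0 : variance H f = 0%E by rewrite -(fineK vfin) v00.
pose r := fine (\int[H]_x (f x)%:E)%E.
have : ae_eq H setT (fun x => ((f x - r) ^+ 2)%:E) (cst 0%E).
  apply/ae_eq_integral_abs => //.
    by apply/measurable_EFinP; apply: measurable_funX; exact: measurable_funB.
  transitivity (variance H f); last exact: V0.
  rewrite /variance unlock unlock; apply: eq_integral => x _.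
  by rewrite gee0_abs ?lee_fin ?sqr_ge0// expr2.
move=> ae0.
have : {ae H, forall x, f x = r}.
  move: ae0; apply: filterS => x /(_ I)[/eqP].
  by rewrite sqrf_eq0 subr_eq0 => /eqP.
move=> [N [mN N0 sub]].
have : H setT = 0%E.
  have mr : measurable (f @^-1` [set r]) by rewrite -[X in measurable X]setTI; exact: mf.
  apply/eqP; rewrite eq_le measure_ge0 andbT.
  apply: (@le_trans _ _ (H (f @^-1` [set r] `|` N))).
    apply: le_measure; rewrite ?inE//; first exact: measurableU.
    move=> x _; have [fx|fx] := pselect (f x = r); first by left.
    by right; apply: sub.
  by apply: (le_trans (measureU2 _ _ _)) => //; rewrite [X in (X + _)%E]H0 [X in (_ + X)%E]N0 adde0.
by rewrite probability_setT => /eqP; rewrite onee_eq0.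
Qed.

(** * Covariances of random masses, and draws given the groups *)

Section random_probability_covariance.
Local Open Scope ereal_scope.
Context (R : realType) d (Omega : measurableType d) (P : probability Omega R).
Context d' (T : measurableType d') (H : probability T R).

Lemma Lfun2_random_probability (p : {RV P >-> pprobability T R}) A : measurable A ->
  (fun w => fine ((p w : probability T R) A)) \in Lfun P 2%:E.
Proof.
move=> mA.
have mp : measurable_fun setT (fun w => fine ((p w : probability T R) A)).
  by apply: measurableT_comp => //; exact: measurable_pprobability.
apply: (Lfun2_le_norm mp (f := cst 1%R)); last exact: Lfun_cst.
move=> w; rewrite normr1 ger0_norm ?fine_ge0// -lee_fin fineK ?fin_num_measure//.
exact: probability_le1.
Qed.

(** With h = H(A), the moment is c h + (1 - c) h^2, and subtracting h^2 leaves c h (1 - h). Taking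
    [p] and [q] equal gives the variance. *)
Lemma covariance_random_probability (p q : {RV P >-> pprobability T R}) A (c : R) :
  measurable A ->
  \int[P]_w (p w : probability T R) A = H A ->
  \int[P]_w (q w : probability T R) A = H A ->
  \int[P]_w ((p w : probability T R) A * (q w : probability T R) A) =
    (mixed_moment H c A A)%:E ->
  covariance P (fun w => fine ((p w : probability T R) A))
    (fun w => fine ((q w : probability T R) A)) =
  (c * (fine (H A) * (1 - fine (H A))))%:E.
Proof.
move=> mA Ep Eq Epq.
have Pfin : P setT \is a fin_num by exact: fin_num_measure.
have p2 := Lfun2_random_probability p mA; have q2 := Lfun2_random_probability q mA.
have fE (r : {RV P >-> pprobability T R}) w :
    (fine ((r w : probability T R) A))%:E = (r w : probability T R) A.
  by rewrite fineK// fin_num_measure.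
rewrite covarianceE; [|exact: Lfun_subset12|exact: Lfun_subset12|exact: Lfun2_mul_Lfun1].
rewrite unlock.
under eq_integral do rewrite EFinM !fE.
under [X in _ - X * _]eq_integral do rewrite fE.
under [X in _ - _ * X]eq_integral do rewrite fE.
rewrite Epq Ep Eq -(fineK (fin_num_measure H A mA)) /mixed_moment setIid /=.
by rewrite -!(EFinM, EFinN, EFinD); congr EFin; ring.
Qed.

End random_probability_covariance.

Section draws.
Local Open Scope ereal_scope.
Context (R : realType) d (Omega : measurableType d) (P : probability Omega R).
Context d' (T : measurableType d') (m : nat).
Variables (G : 'I_m -> {RV P >-> pprobability T R}) (n : 'I_m -> nat).
Variable mu : forall j, 'I_(n j) -> {RV P >-> T}.
Hypothesis mu_draws : draws G mu.

(** Labels are dependent pairs of a group and an index, so [u != v] covers both two draws of one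
    group and draws of two groups. *)
Lemma draws_integral_indic (u v : {j : 'I_m & 'I_(n j)}) A B :
  u != v -> measurable A -> measurable B ->
  \int[P]_w ((\1_A (mu (tagged u) w))%:E * (\1_B (mu (tagged v) w))%:E) =
  \int[P]_w ((G (tag u) w : probability T R) A * (G (tag v) w : probability T R) B).
Proof.
move=> uv mA mB.
pose K := \bigcup_i preimage_set_system setT (G i) measurable.
have KO : <<s K >> `<=` measurable.
  by apply: (@sigma_of_sub_measurable _ _ _ _ 'I_m) => i; exact: measurable_funP.
have := cond_indep_integral2 KO
  (L := fun (u : {j : 'I_m & 'I_(n j)}) w => G (tag u) w)
  (fun _ _ mC => measurable_pprobability (measurable_funP _) mC) mu_draws
  uv mA mB (Y := cst 1) (measurable_cst _) (fun=> lee01).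
by under eq_integral do rewrite mul1e; under [in RHS]eq_integral do rewrite mul1e.
Qed.

End draws.

Theorem proposition1 (R : realType) (D : nat) (hD : (0 < D)%N)
  (U : set 'rV[R]_D) (u0 : set_type U)
  (H : probability (borel_subset u0) R)
  (hH : forall y : borel_subset u0, H [set y] = 0%E)
  (alpha gamma nu : R) (halpha : 0 < alpha) (hgamma : 0 < gamma) (hnu : 0 < nu)
  (dO : measure_display) (Omega : measurableType dO) (P : probability Omega R)
  (m : nat) (G : 'I_m -> {RV P >-> pprobability (borel_subset u0) R})
  (hG : NDP_HDP alpha gamma nu H G)
  (n : 'I_m -> nat) (mu : forall j, 'I_(n j) -> {RV P >-> borel_subset u0})
  (hmu : draws G mu) :
  (forall A : set (borel_subset u0), measurable A ->
    let GA j w := fine ((G j w : probability (borel_subset u0) R) A) in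
    let HA := fine (H A) in
    [/\ forall j, 'E_P[GA j]%E = HA%:E,
        forall j, variance P (GA j)
          = ((alpha + gamma + 1) * HA * (1 - HA)
               / ((alpha + 1) * (gamma + 1)))%:E
      & 0 < HA < 1 -> forall j j', j != j' ->
        correlation P (GA j) (GA j')
          = 1 / (1 + nu)
            * ((nu * gamma + alpha + gamma + nu + 1) / (alpha + gamma + 1))])
  /\
  ((forall g : 'I_D, (fun x => to_rV x ord0 g) \in Lfun H 2%:E) ->
    let c_same := (alpha + gamma + 1) / ((alpha + 1) * (gamma + 1)) in
    let c_diff := (nu * gamma + alpha + gamma + nu + 1)
                    / ((nu + 1) * (alpha + 1) * (gamma + 1)) in
    (D = 1%N -> forall g : 'I_D,
      (forall j i i', i != i' ->
        correlation P (fun w => to_rV (mu j i w) ord0 g)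
                      (fun w => to_rV (mu j i' w) ord0 g) = c_same) /\
      (forall j j' i i', j != j' ->
        correlation P (fun w => to_rV (mu j i w) ord0 g)
                      (fun w => to_rV (mu j' i' w) ord0 g) = c_diff))
    /\
    ((2 <= D)%N ->
      let R_H := correlation_mx H (@to_rV R D U u0) (@to_rV R D U u0) in
      (forall j i i', i != i' ->
        correlation_mx P (fun w => to_rV (mu j i w))
                         (fun w => to_rV (mu j i' w)) = c_same *: R_H) /\
      (forall j j' i i', j != j' ->
        correlation_mx P (fun w => to_rV (mu j i w))
                         (fun w => to_rV (mu j' i' w)) = c_diff *: R_H))).
Proof.
have c_same_01 := same_group_coef_01 halpha hgamma.
have c_diff_01 := diff_group_coef_01 halpha hgamma hnu.
split.
  move=> A mA GA HA.
  have mean j : (\int[P]_w (G j w : probability _ R) A = H A)%E.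
    exact: (NDP_HDP_mean halpha hgamma hnu hG).
  have var j : variance P (GA j) = (same_group_coef alpha gamma * (HA * (1 - HA)))%:E.
    apply: covariance_random_probability => //.
    exact: (NDP_HDP_moment_same halpha hgamma hnu hG).
  split.
  - move=> j; rewrite unlock /HA fineK ?fin_num_measure// -(mean j).
    by apply: eq_integral => w _; rewrite /GA fineK// fin_num_measure.
  - move=> j; rewrite var /same_group_coef; congr EFin.
    by field; rewrite !gt_eqF ?addr_gt0.
  - move=> /andP[HA0 HA1] j j' jj'.
    have cov : covariance P (GA j) (GA j') =
        (diff_group_coef alpha gamma nu * (HA * (1 - HA)))%:E.
      apply: covariance_random_probability => //.
      exact: (NDP_HDP_moment_diff halpha hgamma hnu hG).
    have V0 : 0 < HA * (1 - HA) by rewrite mulr_gt0 ?subr_gt0.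
    (* Both variances agree, so the correlation is the quotient of the two coefficients; the
       positive factor [HA * (1 - HA)] cancels. *)
    rewrite /correlation cov !var/= -expr2 sqr_sqrtr; last first.
      by rewrite mulr_ge0 ?(ltW V0)//; have /andP[] := c_same_01.
    rewrite /same_group_coef /diff_group_coef; field.
    by rewrite !gt_eqF ?subr_gt0 ?addr_gt0 ?addr_gt0.
move=> f2 c_same c_diff.
have same_pair j i i' : i != i' ->
    pair_law H (same_group_coef alpha gamma) (mu j i) (mu j i').
  move=> ii' A B mA mB.
  have uv : Tagged (fun j => 'I_(n j)) i != Tagged (fun j => 'I_(n j)) i'.
    by rewrite eq_Tagged.
  rewrite (draws_integral_indic hmu uv mA mB).
  exact: (NDP_HDP_moment_same halpha hgamma hnu hG).
have diff_pair j j' i i' : j != j' ->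
    pair_law H (diff_group_coef alpha gamma nu) (mu j i) (mu j' i').
  move=> jj' A B mA mB.
  have uv : Tagged (fun j => 'I_(n j)) i != Tagged (fun j => 'I_(n j)) i'.
    by apply: contraNN jj' => /eqP/(congr1 tag)/= ->.
  rewrite (draws_integral_indic hmu uv mA mB).
  exact: (NDP_HDP_moment_diff halpha hgamma hnu hG).
split.
  move=> D1 g.
  have R1 : correlation H (fun x => to_rV x ord0 g) (fun x => to_rV x ord0 g) = 1.
    apply: correlation_id => [|r]; first exact: f2.
    (* In dimension 1 the only coordinate determines the point, so each level set is empty or a
       singleton, and is null because [H] has no atom. *)
    have sub (x y : borel_subset u0) : to_rV x ord0 g = to_rV y ord0 g -> x = y.
      move=> xy; apply: (@val_inj _ _ (set_type U)).
      apply/rowP => k; suff -> : k = g by [].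
      have ord_eq0 (l : 'I_D) : nat_of_ord l = 0%N.
        by have := ltn_ord l; rewrite [X in (l < X)%N]D1 ltnS leqn0 => /eqP.
      by apply: val_inj; rewrite /= !ord_eq0.
    have [[y yr]|none] := pselect (exists y : borel_subset u0, to_rV y ord0 g = r).
      rewrite -[RHS](hH y); congr (H _); apply/seteqP; split=> [x xr|_ ->//].
      by apply: sub; rewrite yr.
    rewrite (_ : _ @^-1` _ = set0) ?measure0// -subset0 => x xr.
    by apply: none; exists x.
  split=> [j i i' ii'|j j' i i' jj'].
    rewrite (correlation_pair c_same_01 (same_pair j i i' ii') (f2 g) (f2 g)).
    by rewrite R1 mulr1.
  rewrite (correlation_pair c_diff_01 (diff_pair j j' i i' jj') (f2 g) (f2 g)).
  by rewrite R1 mulr1.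
move=> _ R_H; split=> [j i i' ii'|j j' i i' jj']; apply/matrixP => g g'; rewrite !mxE.
  exact: (correlation_pair c_same_01 (same_pair j i i' ii') (f2 g) (f2 g')).
exact: (correlation_pair c_diff_01 (diff_pair j j' i i' jj') (f2 g) (f2 g')).
Qed.
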